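(* Let $n\ge1$. For every partition $\boldsymbol p$ of $n$, every $i$ with $1\le i\le\chi_{\boldsymbol p}(1)$, and every $\lambda\ge1$, the commuting $n$-tuple $(M_{s_1},\dots,M_{s_n})$ acting on the Hilbert space $\mathbb P_{\boldsymbol p}^{ii}\big(\mathbb A^{(\lambda)}(\mathbb D^n)\big)$ is a $\Gamma_n$-contraction.
   Context: $\mathbb D^n$ is the open unit polydisc in $\mathbb C^n$. $\mathbb A^{(\lambda)}(\mathbb D^n)$ is the Hilbert space of holomorphic functions on $\mathbb D^n$ with reproducing kernel $\prod_{j=1}^n(1-z_j\bar w_j)^{-\lambda}$. The symmetric group $\mathfrak S_n$ acts on $\mathbb C^n$ by $\sigma\cdot\boldsymbol z=(z_{\sigma^{-1}(1)},\dots,z_{\sigma^{-1}(n)})$, and $(f\circ\sigma^{-1})(\boldsymbol z)=f(\sigma^{-1}\cdot\boldsymbol z)$. For a partition $\boldsymbol p$ of $n$ fix a unitary matrix representation $\boldsymbol\pi_{\boldsymbol p}=(\boldsymbol\pi_{\boldsymbol p}^{ij})$ in the class of irreducible representations of $\mathfrak S_n$ corresponding to $\boldsymbol p$, with character $\chi_{\boldsymbol p}$ and dimension $\chi_{\boldsymbol p}(1)$. Define $\mathbb P_{\boldsymbol p}^{ii}f=\frac{\chi_{\boldsymbol p}(1)}{n!}\sum_{\sigma\in\mathfrak S_n}\boldsymbol\pi_{\boldsymbol p}^{ii}(\sigma^{-1})(f\circ\sigma^{-1})$, an orthogonal projection on $\mathbb A^{(\lambda)}(\mathbb D^n)$. $s_k$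 is the $k$-th elementary symmetric polynomial in $z_1,\dots,z_n$, $\boldsymbol s=(s_1,\dots,s_n)$, and $M_{s_k}$ is the operator of multiplication by $s_k$, for which the range of $\mathbb P_{\boldsymbol p}^{ii}$ is a reducing subspace. $\Gamma_n=\boldsymbol s(\overline{\mathbb D}^{\,n})$ is the closure of the symmetrized polydisc $\boldsymbol s(\mathbb D^n)$. A commuting $n$-tuple $\boldsymbol T$ of bounded operators is a $\Gamma_n$-contraction if $\|q(\boldsymbol T)\|\le\sup_{\boldsymbol u\in\Gamma_n}|q(\boldsymbol u)|$ for every polynomial $q$ in $n$ complex variables. *)

(* Defs.v *)
From HB Require Import structures.
From mathcomp Require Import all_boot all_order all_algebra all_fingroup.
From mathcomp Require Import all_field all_character.
From mathcomp Require Import complex.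
From mathcomp Require Import all_classical all_reals all_analysis.
(* Not imported: the notations of mpoly clash with those of analysis. *)
From mathcomp Require mpoly.

Set Implicit Arguments.
Unset Strict Implicit.
Unset Printing Implicit Defensive.

Import Order.TTheory GRing.Theory Num.Theory.
Import numFieldNormedType.Exports.

Local Open Scope classical_set_scope.
Local Open Scope ring_scope.

(* Hilbert spaces whose vectors live in an ambient C-vector space F: a set
   H of vectors with a form ip, of which only the values on H matter. *)
Section Hilbert.
Variables (R : realType) (F : lmodType R[i]).
Implicit Types (H : set F) (ip : F -> F -> R[i]) (S : F -> F).

Definition hnorm ip (f : F) : R := Num.sqrt (complex.Re (ip f f)).

Record is_hilbert H ip : Prop := IsHilbert {
  hilb_zero : H 0;
  hilb_lin : forall (a : R[i]) f g, H f -> H g -> H (a *: f + g);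
  hilb_ip_lin : forall (a : R[i]) f g h, H f -> H g -> H h ->
    ip (a *: f + g) h = a * ip f h + ip g h;
  hilb_ip_sym : forall f g, H f -> H g -> ip g f = (ip f g)^*;
  hilb_ip_pos : forall f, H f -> f != 0 -> 0 < ip f f;
  hilb_complete : forall u : nat -> F, (forall m, H (u m)) ->
    (forall e : R, 0 < e -> exists N, forall m k, (N <= m)%N -> (N <= k)%N ->
       hnorm ip (u m - u k) < e) ->
    exists2 f, H f & forall e : R, 0 < e -> exists N, forall m, (N <= m)%N ->
       hnorm ip (u m - f) < e
}.

Record bounded_operator H ip S : Prop := BoundedOperator {
  bop_stable : forall f, H f -> H (S f);
  bop_lin : forall (a : R[i]) f g, H f -> H g ->
    S (a *: f + g) = a *: S f + S g;
  bop_bounded : exists M : R, forall f, H f -> hnorm ip (S f) <= M * hnorm ip f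
}.

Definition opnorm H ip S : \bar R :=
  ereal_sup [set (hnorm ip (S f))%:E | f in [set f | H f /\ hnorm ip f <= 1]].

(* The order of the factors is irrelevant as soon as the T k commute. *)
Definition op_monomial n (T : 'I_n -> F -> F) (m : mpoly.multinom n) (f : F)
    : F :=
  foldr (fun k g => iter (mpoly.fun_of_multinom m k) (T k) g) f (enum 'I_n).

Definition op_poly n (T : 'I_n -> F -> F) (q : mpoly.mpoly n R[i]) (f : F)
    : F :=
  \sum_(m <- mpoly.msupp q) mpoly.mcoeff m q *: op_monomial T m f.

End Hilbert.

Section SymmetrizedPolydisc.
Variables (R : realType) (n : nat).
Local Notation C := R[i].

Definition polydisc : set 'rV[C]_n := [set z | forall j, `|z 0 j| < 1].

Definition closed_polydisc : set 'rV[C]_n := [set z | forall j, `|z 0 j| <= 1].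

Definition esym (k : nat) (z : 'rV[C]_n) : C :=
  mpoly.meval (fun j => z 0 j) (mpoly.mesym n C k).

Definition symmap (z : 'rV[C]_n) : 'rV[C]_n := \row_(k < n) esym k.+1 z.

Definition Gamma : set 'rV[C]_n := symmap @` closed_polydisc.

Definition Gamma_contraction (F : lmodType C) (H : set F) (ip : F -> F -> C)
    (T : 'I_n -> F -> F) : Prop :=
  [/\ is_hilbert H ip,
      forall k, bounded_operator H ip (T k),
      forall k l f, H f -> T k (T l f) = T l (T k f) &
      forall q : mpoly.mpoly n C,
        (opnorm H ip (op_poly T q) <=
         ereal_sup [set (Normc.normc (mpoly.meval (fun k => u 0%R k) q))%:E
                   | u in Gamma])%E].

Definition mul_esym (k : 'I_n) (f : 'rV[C]_n -> C) : 'rV[C]_n -> C :=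
  fun z => esym k.+1 z * f z.

End SymmetrizedPolydisc.

Arguments polydisc R n : clear implicits.
Arguments closed_polydisc R n : clear implicits.
Arguments Gamma R n : clear implicits.
Arguments mul_esym {R n} k f.

Section WeightedBergman.
Variables (R : realType) (n : nat) (lam : R).
Local Notation C := R[i].

(* The principal branch of z ^ a for Re z > 0, where the principal argument
   is atan (Im z / Re z); 1 - z * w^* has positive real part for z, w in the
   unit disc. *)
Definition cpow (z : C) (a : R) : C :=
  let t := a * atan (complex.Im z / complex.Re z) in
  ((Normc.normc z `^ a)%:C * (cos t +i* sin t))%C.

Definition polydisc_kernel (z w : 'rV[C]_n) : C :=
  \prod_(j < n) cpow (1 - z 0 j * (w 0 j)^*) (- lam).

(* A function on the polydisc is represented by its extension by 0 to C^n;
   since the polydisc is open, this does not affect differentiability at its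
   points, which over the field C is complex differentiability. *)
Definition holomorphic (f : 'rV[C]_n -> C) : Prop :=
  forall z, polydisc R n z ->
    differentiable (f : 'rV[C^o]_n -> C^o) (z : 'rV[C^o]_n).

Definition kernel_section (w : 'rV[C]_n) : 'rV[C]_n -> C :=
  fun z => if z \in polydisc R n then polydisc_kernel z w else 0.

(* (H, ip) is the Hilbert space of holomorphic functions on the polydisc with
   reproducing kernel polydisc_kernel; these properties determine H and the
   values of ip on H. *)
Record is_bergman_space (H : set ('rV[C]_n -> C))
    (ip : ('rV[C]_n -> C) -> ('rV[C]_n -> C) -> C) : Prop := IsBergmanSpace {
  berg_hilbert : is_hilbert H ip;
  berg_support : forall f, H f -> forall z, ~ polydisc R n z -> f z = 0;
  berg_holo : forall f, H f -> holomorphic f;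
  berg_kernel : forall w, polydisc R n w -> H (kernel_section w);
  berg_reproducing : forall f w, H f -> polydisc R n w ->
    ip f (kernel_section w) = f w
}.

End WeightedBergman.

(* Permutations compose from left to right, (s * t) x = t (s x), and matrix
   representations act on row vectors.  Hence a representation rG of 'S_n in
   the sense below is the transpose of a representation pi for composition
   from right to left acting on column vectors: both describe the same module,
   they are unitary simultaneously and have the same diagonal entries. *)
Section Representations.
Variables (R : realType) (n : nat).
Local Notation C := R[i].
Local Notation Sn := [set: 'S_n]%G.

Definition is_partition (p : seq nat) : bool :=
  [&& sorted geq p, 0%N \notin p & sumn p == n].

(* The boxes of the Young diagram of p are numbered 0, ..., n - 1 row by row,
   so that box k lies in row reshape_index p k and column
   reshape_offset p k. *)
Definition row_stabilizer (p : seq nat) : {set 'S_n} :=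
  [set s : 'S_n | [forall k, reshape_index p (s k) == reshape_index p k]].

Definition col_stabilizer (p : seq nat) : {set 'S_n} :=
  [set s : 'S_n | [forall k, reshape_offset p (s k) == reshape_offset p k]].

(* The sum of sgn(t) (s o t), with s o t = (t * s)%g, as an element of the
   group ring C['S_n]. *)
Definition young_symmetrizer (p : seq nat) : 'rV[C]_#|Sn| :=
  \sum_(s in row_stabilizer p) \sum_(t in col_stabilizer p)
    (-1) ^+ odd_perm t *: gring_row (regular_repr C Sn (t * s)%g).

(* The ideal generated by the Young symmetrizer; right multiplication by s for
   the product of 'S_n is left multiplication by s for composition. *)
Definition specht_repr (p : seq nat) :=
  submod_repr (cyclic_mx_module (regular_repr C Sn) (young_symmetrizer p)).

Definition unitary_irrep_of (p : seq nat) (d : nat)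
    (rG : mx_representation C Sn d) : Prop :=
  [/\ mx_irreducible rG, mx_rsim rG (specht_repr p) &
      forall s : 'S_n, rG s \is unitarymx].

Definition permute (s : 'S_n) (z : 'rV[C]_n) : 'rV[C]_n :=
  \row_j z 0 ((s^-1)%g j).

Definition isotypic_proj (d : nat) (rG : mx_representation C Sn d) (i : 'I_d)
    (f : 'rV[C]_n -> C) : 'rV[C]_n -> C :=
  fun z => d%:R / n`!%:R *
    \sum_(s : 'S_n) rG (s^-1)%g i i * f (permute (s^-1)%g z).

End Representations.

(* Main.v *)
(** By Aronszajn's criterion, multiplication by p maps the reproducing kernel
    Hilbert space H of K into itself with norm at most M as soon as the kernel
    (M^2 - p(z) conj(p(w))) K(z, w) is positive semidefinite.  For the Szego kernel
    (lambda = 1) and a polynomial p with |p| <= M on the closed polydisc, this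
    follows from exact quadrature for polynomials on finite grids of roots of
    unity in the torus.  For lambda >= 1 the remaining factor of K, the kernel
    with exponent lambda - 1 >= 0, is a limit of sums of products of rank one
    kernels with nonnegative coefficients, by the binomial series, so that
    multiplying by it preserves positive semidefiniteness.  Taking p = q o s
    bounds q(M_s) on all of H.  The projection, which is bounded, and idempotent
    by Schur orthogonality, commutes with symmetric multipliers; hence its range
    is a Hilbert space, and inherits the bound. *)
Require Import Defs.
From HB Require Import structures.
From mathcomp Require Import all_boot all_order all_algebra all_fingroup.
From mathcomp Require Import all_field all_character.
From mathcomp Require Import complex.
From mathcomp Require Import all_classical all_reals all_analysis.
From mathcomp Require mpoly.
From mathcomp Require Import ring lra.
(* The notations of mpoly clash with those of analysis. *)
Import (canonicals) mpoly.

Set Implicit Arguments.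
Unset Strict Implicit.
Unset Printing Implicit Defensive.

Import Order.TTheory GRing.Theory Num.Theory.
Import numFieldNormedType.Exports.

Local Open Scope classical_set_scope.
Local Open Scope ring_scope.

(** The space is given only through its reproducing kernel, so that even the membership of p f in H
    has to come from kernel inequalities. The adjoint of multiplication by p should send the kernel
    section k_w to conj(p(w)) k_w, and positivity of the kernel in the criterion says that this map
    has norm at most M on combinations of kernel sections. Hence the functional taking the sum of
    the c_j k_(w_j) to the sum of the c_j conj((p f)(w_j)) is bounded by M times the norm of f, and
    the vector of H that represents it has the values of p f. Grids replace the boundary values of
    Hardy space functions: truncated Szego kernels are polynomials, and for degrees small against
    the grid the mean over the grid equals the integral over the torus. The truncation is removed by
    limits of numbers, as a form involves finitely many points. The bound lambda >= 1 enters through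
    signs: the binomial coefficients for the exponent lambda - 1 are then nonnegative. *)

Section ComplexNumbers.
Variable R : realType.
Implicit Types (x y z : R[i]) (r : R).

Lemma ReD x y : complex.Re (x + y) = complex.Re x + complex.Re y.
Proof. by case: x y => a b [c d]. Qed.

Lemma ReN x : complex.Re (- x) = - complex.Re x.
Proof. by case: x. Qed.

Lemma ReB x y : complex.Re (x - y) = complex.Re x - complex.Re y.
Proof. by rewrite ReD ReN. Qed.

Lemma ReM x y : complex.Re (x * y) =
  complex.Re x * complex.Re y - complex.Im x * complex.Im y.
Proof. by case: x y => a b [c d]. Qed.

Lemma ImM x y : complex.Im (x * y) =
  complex.Re x * complex.Im y + complex.Im x * complex.Re y.
Proof. by case: x y => a b [c d]. Qed.

Lemma Re_conj x : complex.Re x^* = complex.Re x.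
Proof. by case: x. Qed.

Lemma Re_realM r x : complex.Re (r%:C%C * x) = r * complex.Re x.
Proof. by rewrite ReM /= mul0r subr0. Qed.

Lemma ImNiRe x : complex.Re (- 'i%C * x) = complex.Im x.
Proof. by rewrite ReM /= oppr0 mul0r sub0r mulN1r opprK. Qed.

Lemma Re_sum (I : Type) (s : seq I) (P : pred I) (f : I -> R[i]) :
  complex.Re (\sum_(i <- s | P i) f i) = \sum_(i <- s | P i) complex.Re (f i).
Proof. exact: (big_morph _ ReD (erefl : complex.Re 0 = 0)). Qed.

Lemma sqr_normc x : Normc.normc x ^+ 2 = complex.Re x ^+ 2 + complex.Im x ^+ 2.
Proof. by case: x => a b /=; rewrite sqr_sqrtr // addr_ge0 ?sqr_ge0. Qed.

Lemma normc_ge0 x : 0 <= Normc.normc x.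
Proof. by case: x => a b /=; exact: sqrtr_ge0. Qed.

Lemma normr_Re_le x : `|complex.Re x| <= Normc.normc x.
Proof.
rewrite -(@ler_sqr _ _ _) ?nnegrE ?normc_ge0 //.
by rewrite sqr_normc real_normK ?num_real // lerDl sqr_ge0.
Qed.

Lemma Re_le_normc x : complex.Re x <= Normc.normc x.
Proof. exact: le_trans (ler_norm _) (normr_Re_le x). Qed.

Lemma normc_conj x : Normc.normc x^* = Normc.normc x.
Proof. by case: x => a b /=; rewrite sqrrN. Qed.

Lemma conj_real r : (r%:C%C)^* = r%:C%C.
Proof. exact: conjc_real. Qed.

Lemma mulcJ x : x * x^* = (Normc.normc x ^+ 2)%:C%C.
Proof.
rewrite sqr_normc; case: x => a b; apply/eqP; rewrite eq_complex /=.
by apply/andP; split; apply/eqP; ring.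
Qed.

Lemma normc_real r : Normc.normc r%:C%C = `|r|.
Proof. by rewrite /= expr0n addr0 sqrtr_sqr. Qed.

Lemma ler_normcD x y :
  Normc.normc (x + y) <= Normc.normc x + Normc.normc y.
Proof. exact: le_normcD. Qed.

Lemma ler_normc_sum (I : Type) (s : seq I) (P : pred I) (f : I -> R[i]) :
  Normc.normc (\sum_(i <- s | P i) f i) <=
  \sum_(i <- s | P i) Normc.normc (f i).
Proof.
elim/big_rec2: _ => [|i a b _ h]; first by rewrite Normc.normc0.
by rewrite (le_trans (ler_normcD _ _)) // lerD2l.
Qed.

Lemma normc_prod (I : Type) (s : seq I) (P : pred I) (f : I -> R[i]) :
  Normc.normc (\prod_(i <- s | P i) f i) =
  \prod_(i <- s | P i) Normc.normc (f i).
Proof. exact: (big_morph _ (@Normc.normcM R) (@Normc.normc1 R)). Qed.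

Lemma normcX x k : Normc.normc (x ^+ k) = Normc.normc x ^+ k.
Proof. by elim: k => [|k ih]; rewrite ?Normc.normc1 // !exprS Normc.normcM ih. Qed.

End ComplexNumbers.

(** * Hilbert spaces and the interpolation criterion *)

Section HilbertSpaces.
Variables (R : realType) (F : lmodType R[i]) (H : set F) (ip : F -> F -> R[i]).
Hypothesis hH : is_hilbert H ip.
Implicit Types (f g h : F) (a : R[i]).

Local Notation hn := (hnorm ip).

Lemma hilb_scale a f : H f -> H (a *: f).
Proof.
by move=> Hf; have := hilb_lin hH a Hf (hilb_zero hH); rewrite addr0.
Qed.

Lemma hilb_add f g : H f -> H g -> H (f + g).
Proof. by move=> Hf Hg; have := hilb_lin hH 1 Hf Hg; rewrite scale1r. Qed.

Lemma hilb_opp f : H f -> H (- f).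
Proof. by move=> Hf; rewrite -scaleN1r; exact: hilb_scale. Qed.

Lemma hilb_sub f g : H f -> H g -> H (f - g).
Proof. by move=> Hf Hg; apply: hilb_add => //; exact: hilb_opp. Qed.

Lemma hilb_sum (I : Type) (s : seq I) (f : I -> F) :
  (forall i, H (f i)) -> H (\sum_(i <- s) f i).
Proof.
move=> Hf; elim/big_rec: _ => [|i g _ Hg]; first exact: hilb_zero hH.
exact: hilb_add.
Qed.

Lemma ip0l h : H h -> ip 0 h = 0.
Proof.
move=> Hh; have H0 := hilb_zero hH.
have := hilb_ip_lin hH 1 H0 H0 Hh; rewrite scaler0 addr0 mul1r => e.
by apply: (addIr (ip 0 h)); rewrite -e add0r.
Qed.

Lemma ipDl f g h : H f -> H g -> H h -> ip (f + g) h = ip f h + ip g h.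
Proof. by move=> Hf Hg Hh; rewrite -[f]scale1r (hilb_ip_lin hH) // mul1r scale1r. Qed.

Lemma ipZl a f h : H f -> H h -> ip (a *: f) h = a * ip f h.
Proof.
move=> Hf Hh; have H0 := hilb_zero hH.
by rewrite -[a *: f]addr0 (hilb_ip_lin hH) // ip0l // addr0.
Qed.

Lemma ipBl f g h : H f -> H g -> H h -> ip (f - g) h = ip f h - ip g h.
Proof.
by move=> Hf Hg Hh; rewrite -scaleN1r ipDl ?ipZl ?mulN1r //; exact: hilb_scale.
Qed.

Lemma ip_suml (I : Type) (s : seq I) (f : I -> F) h :
  (forall i, H (f i)) -> H h ->
  ip (\sum_(i <- s) f i) h = \sum_(i <- s) ip (f i) h.
Proof.
move=> Hf Hh; elim: s => [|i s ih]; first by rewrite !big_nil ip0l.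
by rewrite !big_cons ipDl ?ih //; exact: hilb_sum.
Qed.

Lemma ipDr f g h : H f -> H g -> H h -> ip h (f + g) = ip h f + ip h g.
Proof.
move=> Hf Hg Hh.
rewrite (hilb_ip_sym hH (hilb_add Hf Hg) Hh) ipDl // rmorphD /=.
by rewrite -!(hilb_ip_sym hH).
Qed.

Lemma ipZr a f h : H f -> H h -> ip h (a *: f) = a^* * ip h f.
Proof.
move=> Hf Hh.
rewrite (hilb_ip_sym hH (hilb_scale a Hf) Hh) ipZl // rmorphM /=.
by rewrite -(hilb_ip_sym hH).
Qed.

Lemma ip_sumr (I : Type) (s : seq I) (f : I -> F) h :
  (forall i, H (f i)) -> H h ->
  ip h (\sum_(i <- s) f i) = \sum_(i <- s) ip h (f i).
Proof.
move=> Hf Hh; rewrite (hilb_ip_sym hH (hilb_sum _ Hf) Hh) ip_suml // rmorph_sum /=.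
by apply: eq_bigr => i _; rewrite -(hilb_ip_sym hH).
Qed.

Lemma hnorm_ge0 f : 0 <= hn f.
Proof. exact: sqrtr_ge0. Qed.

Lemma ip_self_ge0 f : H f -> 0 <= ip f f.
Proof.
move=> Hf; have [->|f0] := eqVneq f 0; last exact/ltW/(hilb_ip_pos hH).
by rewrite ip0l //; exact: hilb_zero hH.
Qed.

Lemma sqr_hnorm f : H f -> hn f ^+ 2 = complex.Re (ip f f).
Proof. by move=> /ip_self_ge0; rewrite lecE => /andP[_ ?]; rewrite sqr_sqrtr. Qed.

Lemma hnorm_eq0 f : H f -> hn f = 0 -> f = 0.
Proof.
move=> Hf f0; apply/eqP/negP => /negP nf.
have := hilb_ip_pos hH Hf nf; rewrite ltcE => /andP[_].
by rewrite -sqr_hnorm // f0 expr0n /= ltxx.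
Qed.

Lemma sqr_hnormDZ f g a : H f -> H g ->
  hn (f + a *: g) ^+ 2 =
  hn f ^+ 2 + complex.Re (a^* * ip f g) *+ 2 + Normc.normc a ^+ 2 * hn g ^+ 2.
Proof.
move=> Hf Hg; have Hag := hilb_scale a Hg.
rewrite !sqr_hnorm //; last exact: hilb_add.
rewrite ipDl ?ipDr ?ipZl ?ipZr //; last exact: hilb_add.
rewrite (hilb_ip_sym hH Hf Hg) mulrA mulcJ !ReD Re_realM.
have -> : a * (ip f g)^* = (a^* * ip f g)^* by rewrite rmorphM /= conjCK.
by rewrite Re_conj mulr2n; ring.
Qed.

Lemma hnormZ a f : H f -> hn (a *: f) = Normc.normc a * hn f.
Proof.
move=> Hf; apply/eqP; rewrite -(@eqrXn2 _ 2) ?mulr_ge0 ?hnorm_ge0 ?normc_ge0 //.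
have := sqr_hnormDZ a (hilb_zero hH) Hf.
rewrite add0r exprMn => ->; rewrite ip0l // mulr0 mul0rn addr0.
by rewrite (sqr_hnorm (hilb_zero hH)) ip0l ?add0r //; exact: hilb_zero hH.
Qed.

Lemma hnorm0 : hn 0 = 0.
Proof.
by rewrite -(scale0r 0) hnormZ ?Normc.normc0 ?mul0r //; exact: hilb_zero hH.
Qed.

Lemma hnormN f : H f -> hn (- f) = hn f.
Proof. by move=> Hf; rewrite -scaleN1r hnormZ // normcN Normc.normc1 mul1r. Qed.

Lemma hnormBC f g : H f -> H g -> hn (f - g) = hn (g - f).
Proof. by move=> Hf Hg; rewrite -opprB hnormN //; exact: hilb_sub. Qed.

Lemma cauchy_schwarz f g : H f -> H g -> Normc.normc (ip f g) <= hn f * hn g.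
Proof.
move=> Hf Hg; have [g0|g0] := eqVneq (hn g) 0.
  rewrite g0 mulr0 (hnorm_eq0 Hg g0) (hilb_ip_sym hH (hilb_zero hH) Hf).
  by rewrite ip0l // normc_conj Normc.normc0.
have g2 : 0 < hn g ^+ 2 by rewrite exprn_gt0 // lt0r g0 hnorm_ge0.
rewrite -(@ler_sqr _ _ _) ?nnegrE ?mulr_ge0 ?hnorm_ge0 ?normc_ge0 //.
(* The vector is [f] minus its orthogonal projection on the line of [g]. *)
have := sqr_ge0 (hn (f + (- (hn g ^+ 2)^-1%:C%C * ip f g) *: g)).
rewrite sqr_hnormDZ // -rmorphN rmorphM /= conj_real -mulrA [_^* * _]mulrC mulcJ.
rewrite Re_realM /= Normc.normcM normc_real.
rewrite exprMn real_normK ?num_real // sqrrN.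
rewrite [(hn f * _) ^+ 2]exprMn.
set N2 := Normc.normc _ ^+ 2; set G := hn g ^+ 2 in g2 *.
have -> : hn f ^+ 2 + - G^-1 * N2 *+ 2 + G^-1 ^+ 2 * N2 * G = hn f ^+ 2 - N2 / G.
  by rewrite mulr2n; field; rewrite gt_eqF.
by rewrite subr_ge0 ler_pdivrMr.
Qed.

Lemma hnormD f g : H f -> H g -> hn (f + g) <= hn f + hn g.
Proof.
move=> Hf Hg; rewrite -(@ler_sqr _ _ _) ?nnegrE ?addr_ge0 ?hnorm_ge0 //.
have := sqr_hnormDZ 1 Hf Hg; rewrite scale1r rmorph1 mul1r Normc.normc1 expr1n mul1r.
move=> ->; have := le_trans (Re_le_normc _) (cauchy_schwarz Hf Hg).
by rewrite sqrrD mulr2n; lra.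
Qed.

Lemma hnorm_sum (I : Type) (s : seq I) (f : I -> F) :
  (forall i, H (f i)) -> hn (\sum_(i <- s) f i) <= \sum_(i <- s) hn (f i).
Proof.
move=> Hf; elim: s => [|i s ih]; first by rewrite !big_nil hnorm0.
rewrite !big_cons (le_trans (hnormD _ _)) ?lerD2l //; exact: hilb_sum.
Qed.

(** Written with the midpoint for use on minimizing sequences: a lower bound at the midpoint turns
    near-minimality of [f] and [g] into closeness. *)
Lemma parallelogram f g : H f -> H g ->
  hn (2^-1 *: (f + g)) ^+ 2 + hn (f - g) ^+ 2 / 4 = (hn f ^+ 2 + hn g ^+ 2) / 2.
Proof.
move=> Hf Hg.
rewrite hnormZ; last exact: hilb_add.
have e1 := sqr_hnormDZ 1 Hf Hg; have e2 := sqr_hnormDZ (- 1) Hf Hg.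
rewrite scale1r rmorph1 mul1r Normc.normc1 in e1.
rewrite scaleN1r rmorphN rmorph1 mulN1r normcN Normc.normc1 ReN in e2.
rewrite exprMn e1 e2 Normc.normcV.
have -> : Normc.normc (2 : R[i]) = 2.
  by rewrite -(rmorph_nat (real_complex R)) normc_real normr_nat.
by rewrite !mulr2n; field.
Qed.

End HilbertSpaces.

Lemma natSinv_small (R : realType) (e : R) : 0 < e ->
  exists N, forall m, (N <= m)%N -> m.+1%:R^-1 < e.
Proof.
move=> e0; have [N _ hN] := near_infty_natSinv_lt (PosNum e0).
by exists N => m /hN.
Qed.

(** * Vectors with prescribed inner products against a given family *)

Section Aronszajn.
Variables (R : realType) (F : lmodType R[i]) (H : set F) (ip : F -> F -> R[i]).
Hypothesis hH : is_hilbert H ip.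
Variables (X : Type) (k : X -> F).
Hypothesis Hk : forall x, H (k x).
Implicit Types (l : seq (R[i] * X)) (phi : X -> R[i]).

Local Notation hn := (hnorm ip).

Definition lincomb l : F := \sum_(t <- l) t.1 *: k t.2.

Lemma lincomb_in l : H (lincomb l).
Proof. by apply: (hilb_sum hH) => t; apply: (hilb_scale hH). Qed.

Lemma sqr_hnorm_lincomb l : hn (lincomb l) ^+ 2 =
  complex.Re (\sum_(s <- l) \sum_(t <- l) s.1 * t.1^* * ip (k s.2) (k t.2)).
Proof.
have Hl := lincomb_in l.
rewrite (sqr_hnorm hH) // {1}/lincomb (ip_suml hH) //; last first.
  by move=> t; apply: (hilb_scale hH).
congr complex.Re; apply: eq_bigr => s _.
rewrite /lincomb (ip_sumr hH) => [|t|]; [|exact: (hilb_scale hH)..].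
apply: eq_bigr => t _.
by rewrite (ipZl hH) ?(ipZr hH) //; [ring|exact: (hilb_scale hH)].
Qed.

(* [h] is the limit of a minimizing sequence, among the linear combinations
   [lincomb l], of the functional [|lincomb l|^2 - 2 Re (lin l)], where
   [lin l] is the value at [lincomb l] which <-, h> must have. *)
Lemma interpolation phi (c : R) : 0 <= c ->
  (forall l, Normc.normc (\sum_(t <- l) t.1 * (phi t.2)^*)
             <= c * hn (lincomb l)) ->
  exists h, [/\ H h, forall x, ip h (k x) = phi x & hn h <= c].
Proof.
pose lin l := \sum_(t <- l) t.1 * (phi t.2)^*.
move=> c0; rewrite -[forall l, _]/(forall l, Normc.normc (lin l) <= _) => hb.
have lincomb_cat l1 l2 : lincomb (l1 ++ l2) = lincomb l1 + lincomb l2.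
  by rewrite /lincomb big_cat.
have lin_cat l1 l2 : lin (l1 ++ l2) = lin l1 + lin l2 by rewrite /lin big_cat.
(* Applied to a concatenation, [half] represents the midpoint of two combinations as a combination
   again, so that [Phi] is at least [m] there. *)
pose half l := [seq (2^-1 * t.1, t.2) | t <- l].
have lincomb_half l : lincomb (half l) = 2^-1 *: lincomb l.
  rewrite /lincomb big_map scaler_sumr.
  by apply: eq_bigr => t _; rewrite /= scalerA.
have lin_half l : lin (half l) = 2^-1%:C%C * lin l.
  rewrite /lin big_map mulr_sumr; apply: eq_bigr => t _ /=.
  by rewrite mulrA fmorphV rmorph_nat.
pose Phi l := hn (lincomb l) ^+ 2 - 2 * complex.Re (lin l).
have Phi_lb l : - c ^+ 2 <= Phi l.
  have := le_trans (Re_le_normc _) (hb l).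
  have := sqr_ge0 (hn (lincomb l) - c); rewrite /Phi sqrrB mulr2n; lra.
pose S := [set Phi l | l in [set: seq (R[i] * X)]].
have S_inf : has_inf S.
  split; first by exists (Phi [::]), [::].
  by exists (- c ^+ 2) => _ [l _ <-].
pose m := inf S.
have m_le l : m <= Phi l by apply: (ge_inf S_inf.2); exists l.
have /boolp.choice[u hu] : forall j, exists l, Phi l < m + j.+1%:R^-1.
  move=> j; have j0 : 0 < j.+1%:R^-1 :> R by rewrite invr_gt0.
  by have [_ [l _ <-] hl] := inf_adherent j0 S_inf; exists l.
pose g j := lincomb (u j).
have Hg j : H (g j) by exact: lincomb_in.
have close i j : hn (g i - g j) ^+ 2 < (i.+1%:R^-1 + j.+1%:R^-1) * 2.
  have h1 := m_le (half (u i ++ u j)); rewrite /Phi lincomb_half lin_half in h1.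
  rewrite lincomb_cat lin_cat Re_realM ReD in h1.
  have h2 := parallelogram hH (Hg i) (Hg j).
  have h3 := hu i; have h4 := hu j; rewrite /Phi -/(g i) -/(g j) in h1 h3 h4.
  rewrite [2 * (2^-1 * _)]mulrA divff // mul1r in h1.
  suff : hn (g i - g j) ^+ 2 / 4 < (i.+1%:R^-1 + j.+1%:R^-1) / 2.
    by rewrite ltr_pdivrMr // -mulrA (_ : 2^-1 * 4 = 2) //; field.
  move: (hn (g i - g j) ^+ 2) (hn (2^-1 *: _) ^+ 2) h1 h2 h3 h4 => A B.
  move: (i.+1%:R^-1) (j.+1%:R^-1) (hn (g i) ^+ 2) (hn (g j) ^+ 2) => a b G1 G2.
  move: (complex.Re _) (complex.Re _) => L1 L2 h1 h2 h3 h4.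
  by lra.
have [||h Hh cvh] := hilb_complete hH (u := g); first exact: Hg.
  move=> e e0; have [|N hN] := @natSinv_small _ (e ^+ 2 / 4).
    by rewrite divr_gt0 // exprn_gt0.
  exists N => i j /hN hi /hN hj.
  rewrite -(@ltr_sqr _ _ _) ?nnegrE ?hnorm_ge0 ?ltW //.
  apply: lt_trans (close i j) _; move: i.+1%:R^-1 j.+1%:R^-1 hi hj => a b.
  by move: (e ^+ 2) => e2 hi hj; lra.
have hphi x : ip h (k x) = phi x.
  pose K := hn (k x) ^+ 2; pose d j := ip (g j) (k x) - phi x.
  have K0 : 0 <= K by exact: sqr_ge0.
  have K1 : 0 < K + 1 by rewrite ltr_wpDl.
  have d_small j : Normc.normc (d j) ^+ 2 <= (K + 1) * j.+1%:R^-1.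
    (* First variation: moving [g j] by [tau *: k x] cannot bring [Phi] below [m], which bounds the
       defect [d j]. The best step would have [s = K^-1]; [K + 1] allows for [k x = 0]. *)
    pose s := (K + 1)^-1; pose tau := - s%:C%C * d j.
    have := m_le ((tau, x) :: u j); rewrite /Phi.
    rewrite /lincomb /lin !big_cons -/(lincomb _) -/(lin _) /= -/(g j) addrC.
    rewrite [_ + g j]addrC (sqr_hnormDZ hH) // ReD.
    have -> : complex.Re (tau * (phi x)^*) = complex.Re (tau^* * phi x).
      by rewrite -Re_conj rmorphM /= conjCK.
    move=> h1; have := hu j; rewrite /Phi -/(g j) -/K => h2.
    have h3 : complex.Re (tau^* * ip (g j) (k x)) - complex.Re (tau^* * phi x)
        = - (s * Normc.normc (d j) ^+ 2).
      rewrite -ReB -mulrBr -/(d j) /tau -rmorphN rmorphM /= conj_real.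
      by rewrite -mulrA [_^* * _]mulrC mulcJ Re_realM /= mulNr.
    have h4 : Normc.normc tau ^+ 2 = s ^+ 2 * Normc.normc (d j) ^+ 2.
      rewrite /tau -rmorphN Normc.normcM normc_real exprMn.
      by rewrite real_normK ?num_real // sqrrN.
    rewrite h4 mulr2n in h1.
    set N2 := Normc.normc (d j) ^+ 2 in h1 h3 *.
    have N20 : 0 <= N2 by exact: sqr_ge0.
    have s0 : 0 < s by rewrite invr_gt0.
    have sK : s * (K + 1) = 1 by rewrite mulVf // gt_eqF.
    have h5 : s ^+ 2 * N2 * K <= s * N2.
      have -> : s ^+ 2 * N2 * K = s * N2 * (s * (K + 1) - s) by ring.
      have s0' := ltW s0.
      by rewrite sK; apply: ler_piMr; [exact: mulr_ge0|rewrite gerBl].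
    have : s * N2 <= j.+1%:R^-1.
      rewrite -/K in h1.
      move: (s * N2) (s ^+ 2 * N2 * K) (hn (g j) ^+ 2) h1 h2 h3 h5 => A B G.
      move: (j.+1%:R^-1) (complex.Re (lin _)) => c1 c2.
      move: (complex.Re _) (complex.Re _) => c3 c4 h1 h2 h3 h5.
      by clearbody m; lra.
    by rewrite mulrC -ler_pdivlMr // invrK mulrC.
  apply/eqP; rewrite -subr_eq0; apply/eqP/Normc.eq0_normc/eqP.
  rewrite eq_le normc_ge0 andbT; apply/ler_addgt0Pr => e e0; rewrite add0r.
  have kx : 0 < hn (k x) + 1 by have := hnorm_ge0 ip (k x); lra.
  have [|N1 hN1] := cvh (e / 2 / (hn (k x) + 1)).
    by rewrite !divr_gt0.
  have [|N2 hN2] := @natSinv_small _ ((e / 2) ^+ 2 / (K + 1)).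
    by rewrite !divr_gt0 ?exprn_gt0 ?divr_gt0 //; lra.
  pose j := maxn N1 N2.
  have -> : ip h (k x) - phi x = ip (h - g j) (k x) + d j.
    by rewrite (ipBl hH) // /d addrA subrK.
  have b1 : Normc.normc (ip (h - g j) (k x)) <= e / 2.
    apply: (le_trans (cauchy_schwarz hH (hilb_sub hH Hh (Hg j)) (Hk x))).
    have := hN1 j (leq_maxl _ _); rewrite (hnormBC hH) // ltr_pdivlMr // => hlt.
    apply: le_trans (ltW hlt); rewrite ler_wpM2l ?hnorm_ge0 //.
    by rewrite lerDl.
  have b2 : Normc.normc (d j) <= e / 2.
    have e2 : 0 <= e / 2 by rewrite divr_ge0 // ltW.
    rewrite -(@ler_sqr _ _ _) ?nnegrE ?normc_ge0 //.
    apply: (le_trans (d_small j)); rewrite mulrC -ler_pdivlMr //.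
    exact/ltW/hN2/leq_maxr.
  by apply: (le_trans (ler_normcD _ _)); lra.
exists h; split=> //; have [h0|h0] := eqVneq (hn h) 0; first by rewrite h0.
have hpos : 0 < hn h by rewrite lt0r h0 hnorm_ge0.
suff : hn h * hn h <= c * hn h by rewrite ler_pM2r.
apply/ler_addgt0Pr => e e0.
have hc : 0 < hn h + c by rewrite ltr_wpDr.
(* Replacing [h] by [g N] costs [hn h * hn (h - g N)] in the inner product and [c * hn (g N - h)] in
   the bound on [lin]; together they stay below [e]. *)
have [|N hN] := cvh (e / (hn h + c)); first by rewrite divr_gt0.
have := hN N (leqnn N); rewrite ltr_pdivlMr // => hlt.
rewrite -expr2 (sqr_hnorm hH) //.
have -> : ip h h = ip h (h - g N) + ip h (g N).
  by rewrite -(ipDr hH) ?subrK //; exact: (hilb_sub hH).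
have -> : ip h (g N) = (lin (u N))^*.
  rewrite /g /lincomb (ip_sumr hH) // => [|t]; last exact: (hilb_scale hH).
  rewrite /lin rmorph_sum /=; apply: eq_bigr => t _.
  by rewrite (ipZr hH) // hphi rmorphM /= conjCK.
have b1 := le_trans (Re_le_normc _)
  (cauchy_schwarz hH Hh (hilb_sub hH Hh (Hg N))).
have b2 := le_trans (Re_le_normc _) (hb (u N)).
have b3 : hn (g N) <= hn h + hn (g N - h).
  by rewrite -{1}(subrKC h (g N)) (hnormD hH) //; exact: (hilb_sub hH).
rewrite ReD Re_conj; rewrite (hnormBC hH) // in b1.
have := ler_wpM2l c0 b3; rewrite /g in b2 b3 *; nra.
Qed.

End Aronszajn.

(** * The binomial series *)

Section PrincipalPower.
Variable R : realType.
Implicit Types (z : R[i]) (a b : R).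

Lemma cpowD z a b : z != 0 -> cpow z (a + b) = cpow z a * cpow z b.
Proof.
move=> z0; have n0 : Normc.normc z != 0.
  by apply: contra z0 => /eqP/Normc.eq0_normc ->.
rewrite /cpow /= powRD ?n0 ?implybT // mulrDl cosD sinD.
by apply/eqP; rewrite eq_complex /=; apply/andP; split; apply/eqP; ring.
Qed.

Lemma cpow0 z : cpow z 0 = 1.
Proof.
rewrite /cpow powRr0 !mul0r cos0 sin0.
by apply/eqP; rewrite eq_complex /=; apply/andP; split; apply/eqP; ring.
Qed.

Lemma cpowNK z a : z != 0 -> cpow z a * cpow z (- a) = 1.
Proof. by move=> z0; rewrite -cpowD // subrr cpow0. Qed.

End PrincipalPower.

Section BinomialCoefficients.
Variable R : realType.
Implicit Types (a r : R) (k : nat).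

(** The rising factorial of [a] divided by [k!], that is, the coefficient of t^k in (1 - t)^(-a). *)
Definition bcoef a k : R := \prod_(j < k) ((a + j%:R) / j.+1%:R).

Lemma bcoef0 a : bcoef a 0 = 1.
Proof. by rewrite /bcoef big_ord0. Qed.

Lemma bcoefS a k : bcoef a k.+1 = bcoef a k * ((a + k%:R) / k.+1%:R).
Proof. by rewrite /bcoef big_ord_recr. Qed.

Lemma bcoef1 k : bcoef 1 k = 1.
Proof.
elim: k => [|k ih]; first exact: bcoef0.
by rewrite bcoefS ih mul1r -natr1 addrC divff // natr1 pnatr_eq0.
Qed.

Lemma bcoef_ge0 a k : 0 <= a -> 0 <= bcoef a k.
Proof.
by move=> a0; apply: prodr_ge0 => j _; rewrite divr_ge0 // addr_ge0.
Qed.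

(** Coefficientwise, the derivative of (1 - t)^(-a) is a (1 - t)^(-a-1). *)
Lemma bcoef_diff a k : k.+1%:R * bcoef a k.+1 = a * bcoef (a + 1) k.
Proof.
elim: k => [|k ih]; first by rewrite bcoefS !bcoef0 addr0; field.
rewrite bcoefS [bcoef (a + 1) _]bcoefS [RHS]mulrA -ih -!natr1; field.
by rewrite !natr1 !pnatr_eq0.
Qed.

(** Coefficientwise, (1 - t)^(-a) is (1 - t) times (1 - t)^(-a-1). *)
Lemma bcoef_pascal a k : bcoef (a + 1) k.+1 = bcoef a k.+1 + bcoef (a + 1) k.
Proof.
have k0 : k.+1%:R != 0 :> R by rewrite pnatr_eq0.
by apply: (mulfI k0); rewrite mulrDr (bcoef_diff a) bcoefS -!natr1 in k0 *; field.
Qed.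

Lemma cvg_series_ratio (u : R ^nat) (q : R) N : (forall k, 0 <= u k) ->
  0 < q < 1 -> (forall k, (N <= k)%N -> u k.+1 <= q * u k) ->
  cvgn (series u).
Proof.
move=> u0 /andP[q0 q1] hu.
(* The sum is a common bound of [u j / q ^+ j] for all [j <= N]; beyond [N] the ratio condition
   propagates it. *)
pose C := \sum_(j < N.+1) u j / q ^+ j.
have uC k : u k <= C * q ^+ k.
  elim: k => [|k ih]; first rewrite expr0 mulr1 /C big_ord_recl /=.
    rewrite expr0 divr1 lerDl sumr_ge0 // => j _.
    by rewrite divr_ge0 // exprn_ge0 // ltW.
  have [kN|kN] := leqP N k.
    by rewrite (le_trans (hu _ kN)) // exprS mulrCA ler_pM2l.
  rewrite -ler_pdivrMr ?exprn_gt0 // /C (bigD1 (Ordinal (kN : k.+1 < N.+1)%N)) //=.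
  by rewrite lerDl sumr_ge0 // => j _; rewrite divr_ge0 // exprn_ge0 // ltW.
have C0 : 0 <= C by rewrite (le_trans (u0 0)) // (le_trans (uC 0)) ?mulr1.
apply: (@series_le_cvg _ _ (geometric C q)) => //.
  by move=> k; rewrite geometric_ge0 // ltW.
by apply: is_cvg_geometric_series; rewrite gtr0_norm.
Qed.

Lemma cvg_series_bcoef a r : 0 <= a -> 0 < r < 1 ->
  cvgn (series (fun k => bcoef a k * r ^+ k)).
Proof.
move=> a0 /andP[r0 r1].
(* From this index on [(a + k) * r <= (1 + r) / 2 * (k + 1)], because [(1 + r) / 2] exceeds [r] by
   [(1 - r) / 2]. *)
have [N _ hN] := nbhs_infty_ger (a * r / ((1 - r) / 2)).
apply: (@cvg_series_ratio _ ((1 + r) / 2) N) => [k||k /hN].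
- by rewrite mulr_ge0 ?bcoef_ge0 ?exprn_ge0 // ltW.
- by apply/andP; split; lra.
rewrite /= ler_pdivrMr; last by lra.
move=> hk; rewrite bcoefS exprS.
rewrite [leRHS]mulrCA [leLHS](_ : _ =
  bcoef a k * ((a + k%:R) / k.+1%:R * r * r ^+ k)); last by ring.
rewrite mulrA [leRHS]mulrA ler_wpM2r ?exprn_ge0 ?(ltW r0) // ler_wpM2l ?bcoef_ge0 //.
rewrite mulrAC ler_pdivrMr // -[k.+1%:R]natr1; move: (k%:R) hk => y hk; lra.
Qed.

End BinomialCoefficients.

Definition cvgC (R : realType) (u : nat -> R[i]) (l : R[i]) : Prop :=
  (complex.Re (u k) @[k --> \oo] --> complex.Re l) /\
  (complex.Im (u k) @[k --> \oo] --> complex.Im l).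

Section BinomialSeries.
Variables (R : realType) (t : R[i]).
Hypothesis t1 : Normc.normc t < 1.
Implicit Types (a s : R) (b : R[i]).

Local Notation x := (complex.Re t).
Local Notation y := (complex.Im t).

(* For real [s], [F a 1 s] and [F a (- 'i) s] are the real and imaginary parts
   of the sum of [bcoef a k * (s t) ^ k], and [P a s], [Q a s] below are those
   of the principal value of [(1 - s t) ^ a].  By the differential equation of
   the binomial series, the product of these two complex functions of [s] has
   derivative zero. *)
Let coef a b k : R := bcoef a k * complex.Re (b * t ^+ k).

Let F a b s : R := limn (pseries (coef a b) s).

Let r : R := (Normc.normc t + 1) / 2.

Let r01 : 0 < r < 1.
Proof. by move: t1 (normc_ge0 t); rewrite /r => h1 h2; apply/andP; split; lra. Qed.

Let tr : Normc.normc t < r.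
Proof. by move: t1; rewrite /r => h; lra. Qed.

(** A radius beyond 1 at which the series still converge, since [r * K = (r ^+ 2 + 1) / 2 < 1]; this
    gives derivatives on all of [0, 1], endpoint included. That [r] lies strictly above the modulus
    of [t] keeps it invertible when [t = 0]. *)
Let K : R := (r + r^-1) / 2.

Let K1 : 1 < K.
Proof.
have /andP[r0 r1] := r01.
have : 1 < r^-1 by rewrite invf_gt1.
have : r * r^-1 = 1 by rewrite divff // gt_eqF.
by rewrite /K; move: r^-1 => v; nra.
Qed.

Let rK : 0 < r * K < 1.
Proof.
have /andP[r0 r1] := r01.
have : r * r^-1 = 1 by rewrite divff // gt_eqF.
have : 0 < r^-1 by rewrite invr_gt0.
by rewrite /K; move: r^-1 => v v0 rv; apply/andP; split; nra.
Qed.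

Let coef_cvg a b : 0 <= a -> cvgn (pseries (coef a b) K).
Proof.
move=> a0; have K0 : 0 <= K by rewrite ltW // (lt_trans _ K1).
have /andP[r0 r1] := r01.
apply: normed_cvg.
apply: (@series_le_cvg _ _ (fun k => Normc.normc b * (bcoef a k * (r * K) ^+ k))).
- by move=> k; exact: normr_ge0.
- move=> k; rewrite mulr_ge0 ?normc_ge0 // mulr_ge0 ?bcoef_ge0 // exprn_ge0 //.
  by case/andP: rK => /ltW.
- move=> k; rewrite /= /coef !normrM ger0_norm ?bcoef_ge0 // normrX (ger0_norm K0).
  rewrite (exprMn _ r K) [leRHS]mulrCA -[leLHS]mulrA ler_wpM2l ?bcoef_ge0 //.
  rewrite [leRHS]mulrA.
  rewrite ler_wpM2r ?exprn_ge0 //.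
  rewrite (le_trans (normr_Re_le _)) // Normc.normcM normcX ler_wpM2l ?normc_ge0 //.
  by rewrite lerXn2r ?nnegrE ?normc_ge0 ?(ltW tr) ?(ltW r0).
exact: (is_cvg_seriesZ (cvg_series_bcoef a0 rK)).
Qed.

Let norm_lt_K s : `|s| <= 1 -> `|s| < `|K|.
Proof. by move=> s1; rewrite (le_lt_trans s1) // (lt_le_trans K1) ?ler_norm. Qed.

Let coef_cvg_inside a b s : 0 <= a -> `|s| <= 1 -> cvgn (pseries (coef a b) s).
Proof.
by move=> a0 s1; exact: (is_cvg_pseries_inside (coef_cvg a0) (norm_lt_K s1)).
Qed.

(** Differentiation in [s] produces a factor [t], and the parameter [b] is there to absorb it. *)
Let coef_diffs a b : pseries_diffs (coef a b) = a *: coef (a + 1) (b * t).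
Proof.
apply/funext => k; rewrite /pseries_diffs /coef mulrA bcoef_diff exprS mulrA.
by rewrite -mulrA.
Qed.

Let pseriesZ c (u : R ^nat) s : pseries (c *: u) s = c *: pseries u s.
Proof.
apply/funext => n; rewrite /pseries /series /= -[RHS]/(c * _) mulr_sumr.
by apply: eq_bigr => k _; rewrite mulrA.
Qed.

Let coef_derive a b s : 0 <= a -> `|s| <= 1 ->
  is_derive s 1 (F a b) (a * F (a + 1) (b * t) s).
Proof.
move=> a0 s1; have a1 : 0 <= a + 1 by rewrite addr_ge0.
have a2 : 0 <= a + 1 + 1 by rewrite addr_ge0.
have -> : a * F (a + 1) (b * t) s = limn (pseries (pseries_diffs (coef a b)) s).
  by rewrite coef_diffs pseriesZ limZl_tmp //; exact: coef_cvg_inside.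
apply: (@pseries_snd_diffs _ _ K).
- exact: coef_cvg.
- by rewrite coef_diffs pseriesZ; apply: is_cvgZl_tmp; exact: coef_cvg.
- have -> : pseries_diffs (pseries_diffs (coef a b)) =
      a *: ((a + 1) *: coef (a + 1 + 1) (b * t * t)).
    rewrite coef_diffs -[(a + 1) *: _]coef_diffs; apply/funext => k.
    by rewrite /pseries_diffs /= -[LHS]/(_ * (a * _)) mulrCA.
  by rewrite !pseriesZ; do 2 apply: is_cvgZl_tmp; exact: coef_cvg.
- exact: norm_lt_K.
Qed.

(** Summed form of [bcoef_pascal]. Together with [coef_derive] it yields the differential equation
    (1 - s t) f' = a t f for the complex sum f. *)
Let coef_shift a b s : 0 <= a -> `|s| <= 1 ->
  F (a + 1) b s = F a b s + s * F (a + 1) (b * t) s.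
Proof.
move=> a0 s1; have a1 : 0 <= a + 1 by rewrite addr_ge0.
have h1 := coef_cvg_inside (b := b) a0 s1.
have h2 := coef_cvg_inside (b := b * t) a1 s1.
apply: cvg_lim => //; rewrite -cvg_shiftS.
have -> : [sequence pseries (coef (a + 1) b) s n.+1]_n =
    (fun n => pseries (coef a b) s n.+1 + s * pseries (coef (a + 1) (b * t)) s n).
  apply/funext => n; rewrite /= /pseries /series /= !big_nat_recl //.
  rewrite {1 3}/coef !bcoef0 -addrA; congr (_ + _).
  rewrite mulr_sumr -big_split; apply: eq_bigr => k _ /=.
  rewrite /coef bcoef_pascal [t ^+ _]exprS mulrA [s ^+ _]exprS; ring.
apply: cvgD; first by rewrite cvg_shiftS.
exact: cvgZl_tmp.
Qed.

Let F0 a b : F a b 0 = complex.Re b.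
Proof.
apply: cvg_lim => //; rewrite -cvg_shiftS.
rewrite (_ : [sequence _]_n = cst (complex.Re b)); first exact: cvg_cst.
apply/funext => n; rewrite /= /pseries /series /= big_nat_recl // big1 => [|k _].
  by rewrite /coef bcoef0 !expr0 addr0 !mulr1 mul1r.
by rewrite expr0n /= mulr0.
Qed.

Let F_lin a b1 b2 (u v : R) s : 0 <= a -> `|s| <= 1 ->
  F a (u%:C%C * b1 + v%:C%C * b2) s = u * F a b1 s + v * F a b2 s.
Proof.
move=> a0 s1; apply: cvg_lim => //.
rewrite (_ : pseries _ s = (fun n => u * pseries (coef a b1) s n +
    v * pseries (coef a b2) s n)); last first.
  apply/funext => n; rewrite /= /pseries /series /= !mulr_sumr -big_split.
  apply: eq_bigr => k _ /=; rewrite /coef mulrDl -!mulrA ReD !Re_realM; ring.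
by apply: cvgD; apply: cvgZl_tmp; exact: coef_cvg_inside.
Qed.

(** For 1 - s t, these are the real part [N], the squared modulus [D], the power [E] of the modulus
    and the principal argument [Th]. They are built from operations on functions so that
    [is_derive_eq] can infer their derivatives. *)
Let N : R -> R := cst 1 - x *: id.
Let D : R -> R := N ^+ 2 + (y *: id) ^+ 2.
Let E a : R -> R := @expR R \o (a / 2 *: (@ln R \o D)).
Let Th : R -> R := @atan R \o ((- y *: id) * (fun s => (N s)^-1)).
Let P a : R -> R := E a * (@cos R \o (a *: Th)).
Let Q a : R -> R := E a * (@sin R \o (a *: Th)).

Let NE s : N s = 1 - x * s. Proof. by []. Qed.
Let DE s : D s = (N s) ^+ 2 + (y * s) ^+ 2. Proof. by []. Qed.

Let dN s : is_derive s (1 : R) N (- x).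
Proof. by apply: is_derive_eq; rewrite sub0r scaler1. Qed.

Let dE a s : 0 < N s ->
  is_derive s (1 : R) (E a) (a * ((- x * N s + s * y ^+ 2) / D s) * E a s).
Proof.
move=> N0; have D0 : 0 < D s by rewrite DE ltr_pwDl ?exprn_gt0 // sqr_ge0.
have dln := is_derive1_ln D0.
apply: is_derive_eq; rewrite /= !fctE /GRing.scale /= -/(D s).
by rewrite /E /= !fctE /GRing.scale /= -/(D s); field; rewrite gt_eqF.
Qed.

Let dTh s : 0 < N s -> is_derive s (1 : R) Th (- y / D s).
Proof.
move=> N0; have N0' : N s != 0 by rewrite gt_eqF.
have D0 : D s != 0 by rewrite gt_eqF // DE ltr_pwDl ?exprn_gt0 // sqr_ge0.
have dV := is_deriveV N0' (dN s).
apply: is_derive_eq; rewrite /= !fctE /GRing.scale /= -/(N s).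
move: D0; rewrite DE NE in N0' * => D0; field.
by apply/andP; split; [exact: D0|exact: N0'].
Qed.

Let dP a s : 0 < N s -> is_derive s (1 : R) (P a)
  (a * ((- x * N s + s * y ^+ 2) / D s) * P a s - a * (- y / D s) * Q a s).
Proof.
move=> N0; have dE1 := dE a N0; have dTh1 := dTh N0.
apply: is_derive_eq; rewrite /= !fctE /GRing.scale /= /P /Q /= !fctE /=.
rewrite /GRing.scale /=; ring.
Qed.

Let dQ a s : 0 < N s -> is_derive s (1 : R) (Q a)
  (a * ((- x * N s + s * y ^+ 2) / D s) * Q a s + a * (- y / D s) * P a s).
Proof.
move=> N0; have dE1 := dE a N0; have dTh1 := dTh N0.
apply: is_derive_eq; rewrite /= !fctE /GRing.scale /= /P /Q /= !fctE /=.
rewrite /GRing.scale /=; ring.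
Qed.

Let N_gt0 s : 0 <= s <= 1 -> 0 < N s.
Proof.
move=> /andP[s0 s1]; rewrite NE subr_gt0 (le_lt_trans _ t1) //.
have /(le_trans (ler_norm _)) h := normr_Re_le t.
have [x0|x0] := leP 0 x; last first.
  by rewrite (le_trans _ (normc_ge0 t)) // mulr_le0_ge0 // ltW.
by rewrite (le_trans _ h) // ler_piMr.
Qed.

Let cpow_affine a s : 0 < N s ->
  cpow (1 - s%:C%C * t) a = (P a s +i* Q a s)%C.
Proof.
move=> N0; have D0 : 0 < D s by rewrite DE ltr_pwDl ?exprn_gt0 // sqr_ge0.
have hRe : complex.Re (1 - s%:C%C * t) = N s by rewrite ReB Re_realM NE mulrC.
have hIm : complex.Im (1 - s%:C%C * t) = - y * s.
  by rewrite /= ; case: (t) => u v /=; ring.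
have hn : Normc.normc (1 - s%:C%C * t) = Num.sqrt (D s).
  apply/eqP; rewrite -(@eqrXn2 _ 2) ?normc_ge0 ?sqrtr_ge0 // sqr_normc.
  by rewrite sqr_sqrtr ?(ltW D0) // hRe hIm DE mulNr sqrrN.
have hE : Num.sqrt (D s) `^ a = E a s.
  rewrite /powR gt_eqF ?sqrtr_gt0 // /E /= !fctE /GRing.scale /=; congr expR.
  rewrite -{2}[D s]sqr_sqrtr ?(ltW D0) // lnXn ?sqrtr_gt0 //.
  by rewrite -mulr_natl; field.
rewrite /cpow hn hE hRe hIm -[a * atan _]/((a *: Th) s).
by apply/eqP; rewrite eq_complex /= !mul0r subr0 addr0 /P /Q !eqxx.
Qed.

Lemma binomial_series a : 0 <= a ->
  cvgC (fun n => \sum_(k < n) (bcoef a k)%:C%C * t ^+ k) (cpow (1 - t) (- a)).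
Proof.
move=> a0; have a1 : 0 <= a + 1 by rewrite addr_ge0.
pose U := F a 1; pose V := F a (- 'i%C).
have in01 s : 0 <= s <= 1 -> `|s| <= 1 by case/andP => s0 s1; rewrite ger0_norm.
pose U1 := F (a + 1) 1; pose V1 := F (a + 1) (- 'i%C).
(* [Ft] and [Fit] compute the real and imaginary parts of [t] times the sum for [a + 1], whose own
   parts are [U1] and [V1]. *)
have Ft s : 0 <= s <= 1 -> F (a + 1) (1 * t) s = x * U1 s - y * V1 s.
  move=> /in01 s1; rewrite -mulNr -F_lin //; congr (F _ _ _).
  case: (t) => u v; apply/eqP; rewrite eq_complex /=.
  by apply/andP; split; apply/eqP; ring.
have Fit s : 0 <= s <= 1 -> F (a + 1) (- 'i%C * t) s = y * U1 s + x * V1 s.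
  move=> /in01 s1; rewrite -F_lin //; congr (F _ _ _).
  case: (t) => u v; apply/eqP; rewrite eq_complex /=.
  by apply/andP; split; apply/eqP; ring.
have dU s : 0 <= s <= 1 -> is_derive s (1 : R) U (a * (x * U1 s - y * V1 s)).
  by move=> hs; rewrite -Ft //; apply: coef_derive => //; exact: in01.
have dV s : 0 <= s <= 1 -> is_derive s (1 : R) V (a * (y * U1 s + x * V1 s)).
  by move=> hs; rewrite -Fit //; apply: coef_derive => //; exact: in01.
have eU s : 0 <= s <= 1 -> U s = U1 s - s * (x * U1 s - y * V1 s).
  by move=> hs; rewrite -Ft // /U1 coef_shift ?addrK //; exact: in01.
have eV s : 0 <= s <= 1 -> V s = V1 s - s * (y * U1 s + x * V1 s).
  by move=> hs; rewrite -Fit // /V1 coef_shift ?addrK //; exact: in01.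
have const (f : R -> R) : (forall s, 0 <= s <= 1 -> is_derive s (1 : R) f 0) ->
    f 1 = f 0.
  move=> hf; have [||c _] := @MVT_segment R f (cst 0) 0 1 ler01.
  - move=> s; rewrite in_itv /= => /andP[s0 s1]; apply: hf.
    by rewrite !ltW.
  - apply: derivable_within_continuous => s; rewrite in_itv /= => hs.
    by have := hf _ hs.
  by rewrite /= mul0r => /eqP; rewrite subr_eq0 => /eqP.
(* [W1] and [Z1] treat the real and the imaginary part of the product, whose value at 0 is 1. *)
have W1 : (U * P a - V * Q a) 1 = (U * P a - V * Q a) 0.
  apply: const => s hs; have N0 := N_gt0 hs.
  have h1 := dU _ hs; have h2 := dV _ hs; have h3 := dP a N0; have h4 := dQ a N0.
  apply: is_derive_eq; rewrite /GRing.scale /= eU // eV //.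
  have D0 : D s != 0 by rewrite gt_eqF // DE ltr_pwDl ?exprn_gt0 // sqr_ge0.
  rewrite DE NE in D0 *; field; exact: D0.
have Z1 : (U * Q a + V * P a) 1 = (U * Q a + V * P a) 0.
  apply: const => s hs; have N0 := N_gt0 hs.
  have h1 := dU _ hs; have h2 := dV _ hs; have h3 := dP a N0; have h4 := dQ a N0.
  apply: is_derive_eq; rewrite /GRing.scale /= eU // eV //.
  have D0 : D s != 0 by rewrite gt_eqF // DE ltr_pwDl ?exprn_gt0 // sqr_ge0.
  rewrite DE NE in D0 *; field; exact: D0.
have Th0 : Th 0 = 0 by rewrite /Th /= !fctE /GRing.scale /= mulr0 mul0r atan0.
have D00 : D 0 = 1 by rewrite DE NE !mulr0 subr0 expr1n expr0n addr0.
have E0 : E a 0 = 1.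
  by rewrite /E /= !fctE /GRing.scale /= -/(D 0) D00 ln1 mulr0 expR0.
have P0 : P a 0 = 1.
  by rewrite /P !fctE E0 /= -[X in cos X]/(a * Th 0) Th0 mulr0 cos0 mulr1.
have Q0 : Q a 0 = 0.
  by rewrite /Q !fctE E0 /= -[X in sin X]/(a * Th 0) Th0 mulr0 sin0 mulr0.
rewrite !fctE P0 Q0 /U /V !F0 /= !mulr0 oppr0 mul0r !mulr1 ?subr0 ?addr0 -/U -/V
  in W1 Z1.
have N1 : 0 < N 1 by apply: N_gt0; rewrite ler01 lexx.
have cpow1 : cpow (1 - t) a = (P a 1 +i* Q a 1)%C.
  by rewrite -cpow_affine // mul1r.
have t1' : 1 - t != 0.
  apply/eqP => h; move: N1.
  by rewrite NE mulr1 -[1]/(complex.Re (1 : R[i])) -ReB h ltxx.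
have -> : cpow (1 - t) (- a) = (U 1 +i* V 1)%C.
  have h : (U 1 +i* V 1)%C * cpow (1 - t) a = 1.
    by rewrite cpow1; apply/eqP; rewrite eq_complex /= W1 Z1 !eqxx.
  by rewrite -[RHS]mulr1 -[in RHS](cpowNK a t1') mulrA h mul1r.
have hs : `|1 : R| <= 1 by rewrite normr1.
split.
  rewrite (_ : (fun n => _) = pseries (coef a 1) 1); first exact: coef_cvg_inside.
  apply/funext => n; rewrite Re_sum /pseries /series /= big_mkord.
  by apply: eq_bigr => k _; rewrite Re_realM expr1n mulr1 /coef mul1r.
rewrite (_ : (fun n => _) = pseries (coef a (- 'i%C)) 1).
  exact: coef_cvg_inside.
apply/funext => n; rewrite -ImNiRe /pseries /series /= big_mkord.
rewrite mulr_sumr Re_sum; apply: eq_bigr => k _.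
by rewrite mulrCA Re_realM expr1n mulr1 /coef.
Qed.

End BinomialSeries.

Section ComplexLimits.
Variable R : realType.
Implicit Types (u v : nat -> R[i]) (l m : R[i]).

Lemma cvgC_cst l : cvgC (fun=> l) l.
Proof. by split; exact: cvg_cst. Qed.

Lemma cvgCD u v l m : cvgC u l -> cvgC v m -> cvgC (fun k => u k + v k) (l + m).
Proof.
move=> [ul1 ul2] [vm1 vm2]; split.
  rewrite ReD; under eq_fun do rewrite ReD; exact: cvgD.
rewrite -ImNiRe mulrDr ReD !ImNiRe.
by under eq_fun do rewrite -ImNiRe mulrDr ReD !ImNiRe; exact: cvgD.
Qed.

Lemma cvgCM u v l m : cvgC u l -> cvgC v m -> cvgC (fun k => u k * v k) (l * m).
Proof.
move=> [ul1 ul2] [vm1 vm2]; split.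
  by rewrite ReM; under eq_fun do rewrite ReM; apply: cvgB; exact: cvgM.
by rewrite ImM; under eq_fun do rewrite ImM; apply: cvgD; exact: cvgM.
Qed.

Lemma cvgC_sum (I : Type) (s : seq I) (u : I -> nat -> R[i]) (l : I -> R[i]) :
  (forall i, cvgC (u i) (l i)) ->
  cvgC (fun k => \sum_(i <- s) u i k) (\sum_(i <- s) l i).
Proof.
move=> ul; elim: s => [|i s ih].
  by rewrite big_nil; under [fun k => _]eq_fun do rewrite big_nil; exact: cvgC_cst.
rewrite big_cons; under [fun k => _]eq_fun do rewrite big_cons.
exact: cvgCD.
Qed.

Lemma cvgC_prod (I : Type) (s : seq I) (u : I -> nat -> R[i]) (l : I -> R[i]) :
  (forall i, cvgC (u i) (l i)) ->
  cvgC (fun k => \prod_(i <- s) u i k) (\prod_(i <- s) l i).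
Proof.
move=> ul; elim: s => [|i s ih].
  by rewrite big_nil; under [fun k => _]eq_fun do rewrite big_nil; exact: cvgC_cst.
rewrite big_cons; under [fun k => _]eq_fun do rewrite big_cons.
exact: cvgCM.
Qed.

Lemma cvgC_shift D u l : cvgC u l -> cvgC (fun k => u (k + D)%N) l.
Proof.
move=> [ul1 ul2]; split.
  by rewrite (cvg_shiftn D (fun k => complex.Re (u k))).
by rewrite (cvg_shiftn D (fun k => complex.Im (u k))).
Qed.

End ComplexLimits.

(** * Positive semidefinite kernels *)

Section PositiveKernels.
Variables (R : realType) (X : Type).
Implicit Types (A k : X -> X -> R[i]) (l : seq (R[i] * X)).

Definition hform A l : R[i] :=
  \sum_(s <- l) \sum_(t <- l) s.1 * t.1^* * A s.2 t.2.

(** On Hermitian kernels the form is real, and this is the usual notion. *)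
Definition psd A := forall l, 0 <= complex.Re (hform A l).

(* Schur multipliers are defined by their action, which makes their stability
   under products immediate; the Schur product theorem is not needed. *)
Definition schur k := forall A, psd A -> psd (fun x y => k x y * A x y).

Lemma hform_lim (A_ : nat -> X -> X -> R[i]) A l :
  (forall x y, cvgC (fun j => A_ j x y) (A x y)) ->
  cvgC (fun j => hform (A_ j) l) (hform A l).
Proof.
move=> hA; apply: cvgC_sum => s; apply: cvgC_sum => t.
by apply: cvgCM => //; exact: cvgC_cst.
Qed.

(** Pointwise convergence is enough, since each form involves finitely many points. *)
Lemma psd_lim (A_ : nat -> X -> X -> R[i]) A : (forall j, psd (A_ j)) ->
  (forall x y, cvgC (fun j => A_ j x y) (A x y)) -> psd A.
Proof.
move=> hpsd hA l; have [hl _] := hform_lim l hA.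
rewrite -(cvg_lim _ hl) //; apply: limr_ge; first exact: cvgP hl.
by near=> j; exact: hpsd.
Unshelve. all: by end_near. Qed.

Lemma schur_lim (k_ : nat -> X -> X -> R[i]) k : (forall j, schur (k_ j)) ->
  (forall x y, cvgC (fun j => k_ j x y) (k x y)) -> schur k.
Proof.
move=> hk kk A hA; apply: (@psd_lim (fun j x y => k_ j x y * A x y)).
  by move=> j; exact: hk.
by move=> x y; apply: cvgCM => //; exact: cvgC_cst.
Qed.

(** The factors [g x] and [(g y)^*] are absorbed into the coefficients of the form. *)
Lemma schur_rank_one (c : R) (g : X -> R[i]) : 0 <= c ->
  schur (fun x y => c%:C%C * (g x * (g y)^*)).
Proof.
move=> c0 A hA l; have := hA [seq (s.1 * g s.2, s.2) | s <- l].
rewrite /hform big_map; under eq_bigr do rewrite big_map.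
move=> h; rewrite (_ : \sum_(s <- l) _ = c%:C%C *
    \sum_(s <- l) \sum_(t <- l) s.1 * g s.2 * (t.1 * g t.2)^* * A s.2 t.2).
  by rewrite Re_realM mulr_ge0.
rewrite mulr_sumr; apply: eq_bigr => s _; rewrite mulr_sumr.
by apply: eq_bigr => t _; rewrite rmorphM /=; ring.
Qed.

Lemma schur0 : schur (fun _ _ => 0).
Proof.
move=> A _ l; rewrite /hform big1 // => s _; rewrite big1 // => t _.
by rewrite mul0r mulr0.
Qed.

Lemma schurD k1 k2 : schur k1 -> schur k2 -> schur (fun x y => k1 x y + k2 x y).
Proof.
move=> h1 h2 A hA l; have := addr_ge0 (h1 A hA l) (h2 A hA l).
rewrite -ReD /hform -big_split /=; congr (_ <= complex.Re _).
apply: eq_bigr => s _; rewrite -big_split; apply: eq_bigr => t _ /=; ring.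
Qed.

Lemma schur1 : schur (fun _ _ => 1).
Proof.
move=> A hA l; have := hA l; rewrite /hform; congr (_ <= complex.Re _).
by apply: eq_bigr => s _; apply: eq_bigr => t _; rewrite mul1r.
Qed.

Lemma schurM k1 k2 : schur k1 -> schur k2 -> schur (fun x y => k1 x y * k2 x y).
Proof.
move=> h1 h2 A hA; have := h1 _ (h2 _ hA).
by congr psd; apply/funext => x; apply/funext => y; rewrite mulrA.
Qed.

Lemma schur_sum (I : Type) (s : seq I) (k : I -> X -> X -> R[i]) :
  (forall i, schur (k i)) -> schur (fun x y => \sum_(i <- s) k i x y).
Proof.
move=> hk; elim: s => [|i s ih].
  rewrite (_ : (fun _ _ => _) = (fun _ _ => 0)); first exact: schur0.
  by apply/funext => x; apply/funext => y; rewrite big_nil.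
rewrite (_ : (fun _ _ => _) =
  (fun x y => k i x y + \sum_(j <- s) k j x y)); first exact: schurD.
by apply/funext => x; apply/funext => y; rewrite big_cons.
Qed.

Lemma schur_prod (I : Type) (s : seq I) (k : I -> X -> X -> R[i]) :
  (forall i, schur (k i)) -> schur (fun x y => \prod_(i <- s) k i x y).
Proof.
move=> hk; elim: s => [|i s ih].
  rewrite (_ : (fun _ _ => _) = (fun _ _ => 1)); first exact: schur1.
  by apply/funext => x; apply/funext => y; rewrite big_nil.
rewrite (_ : (fun _ _ => _) =
  (fun x y => k i x y * \prod_(j <- s) k j x y)); first exact: schurM.
by apply/funext => x; apply/funext => y; rewrite big_cons.
Qed.

End PositiveKernels.

Section RootsOfUnity.
Variable R : realType.
Local Notation C := R[i].

Lemma primitive_root_exists N : (0 < N)%N -> exists w : C, N.-primitive_root w.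
Proof.
move=> N0; have [r Dp] := closed_field_poly_normal ('X^N - 1 : {poly C}).
have monp : 'X^N - 1 \is @monic C by exact: monicXnsubC.
rewrite (monicP monp) scale1r in Dp.
have sz : (N <= size r)%N.
  by rewrite -ltnS -(size_prod_XsubC r id) -Dp size_XnsubC.
have rr : all N.-unity_root r.
  by apply/allP => z; rewrite -root_prod_XsubC -Dp.
suff ur : uniq r by have /hasP[w _ hw] := cyclic.has_prim_root N0 rr ur sz; exists w.
rewrite -separable_prod_XsubC -Dp; apply: separable_Xn_sub_1.
by rewrite pnatr_eq0 -lt0n.
Qed.

End RootsOfUnity.

(** * Polynomials and quadrature on the torus *)

Section PolynomialFunctions.
Variables (R : realType) (n : nat).
Local Notation C := R[i].
Implicit Types (p q : 'rV[C]_n -> C) (d : nat) (z w : 'rV[C]_n).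

Definition monomial (m : {ffun 'I_n -> nat}) z : C := \prod_(j < n) z 0 j ^+ m j.

(* The degree in each variable separately is less than [d]. *)
Definition polydeg d p : Prop := exists s : seq (C * {ffun 'I_n -> nat}),
  (forall t, t \in s -> forall j, (t.2 j < d)%N) /\
  forall z, p z = \sum_(t <- s) t.1 * monomial t.2 z.

Lemma polydeg_monomial d (m : {ffun 'I_n -> nat}) (c : C) : (forall j, (m j < d)%N) ->
  polydeg d (fun z => c * monomial m z).
Proof.
move=> md; exists [:: (c, m)]; split=> [t|z]; last by rewrite big_seq1.
by rewrite inE => /eqP ->.
Qed.

Lemma polydeg0 d : polydeg d (fun=> 0).
Proof. by exists [::]; split=> // z; rewrite big_nil. Qed.

Lemma polydegD d p q : polydeg d p -> polydeg d q -> polydeg d (fun z => p z + q z).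
Proof.
move=> [s [sd sp]] [s' [sd' sq]]; exists (s ++ s'); split=> [t|z].
  by rewrite mem_cat => /orP[/sd|/sd'].
by rewrite big_cat sp sq.
Qed.

Lemma polydegZ d c p : polydeg d p -> polydeg d (fun z => c * p z).
Proof.
move=> [s [sd sp]]; exists [seq (c * t.1, t.2) | t <- s]; split=> [t|z].
  by move=> /mapP[t' /sd td ->].
by rewrite big_map sp mulr_sumr; apply: eq_bigr => t _; rewrite mulrA.
Qed.

Lemma polydeg_sum d (I : Type) (s : seq I) (P : pred I) (p : I -> 'rV[C]_n -> C) :
  (forall i, P i -> polydeg d (p i)) ->
  polydeg d (fun z => \sum_(i <- s | P i) p i z).
Proof.
move=> hp; elim: s => [|i s ih].
  rewrite (_ : (fun _ => _) = (fun=> 0)); first exact: polydeg0.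
  by apply/funext => z; rewrite big_nil.
have [Pi|Pi] := boolP (P i).
  rewrite (_ : (fun _ => _) = fun z => p i z + \sum_(j <- s | P j) p j z).
    by apply: polydegD => //; exact: hp.
  by apply/funext => z; rewrite big_cons Pi.
rewrite (_ : (fun _ => _) = fun z => \sum_(j <- s | P j) p j z) //.
by apply/funext => z; rewrite big_cons (negbTE Pi).
Qed.

Lemma polydegM d d' p q : polydeg d p -> polydeg d' q ->
  polydeg (d + d') (fun z => p z * q z).
Proof.
move=> [s [sd sp]] [s' [sd' sq]].
(* The membership filters hand the degree bounds of the terms to [polydeg_sum]. *)
rewrite (_ : (fun _ => _) = fun z => \sum_(t <- s | t \in s)
  \sum_(u <- s' | u \in s') t.1 * u.1 * monomial [ffun j => t.2 j + u.2 j]%N z).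
  apply: polydeg_sum => t ts; apply: polydeg_sum => u us.
  apply: polydeg_monomial => j; rewrite ffunE.
  by rewrite -addSn leq_add ?sd // ltnW // sd'.
apply/funext => z; rewrite sp sq mulr_suml -[RHS]big_seq.
apply: eq_bigr => t _; rewrite mulr_sumr -[RHS]big_seq; apply: eq_bigr => u _.
rewrite mulrACA /monomial -big_split; congr (_ * _).
by apply: eq_bigr => j _; rewrite ffunE exprD.
Qed.

Lemma polydeg_leq d d' p : (d <= d')%N -> polydeg d p -> polydeg d' p.
Proof.
move=> dd [s [sd sp]]; exists s; split=> // t ts j.
exact: leq_trans (sd t ts j) dd.
Qed.

Lemma polydeg_cst (c : C) : polydeg 1 (fun=> c).
Proof.
rewrite (_ : (fun=> c) = fun z => c * monomial [ffun=> 0%N] z).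
  by apply: polydeg_monomial => j; rewrite ffunE.
by apply/funext => z; rewrite /monomial big1 ?mulr1 // => j _; rewrite ffunE.
Qed.

Lemma polydeg_coord j : polydeg 2 (fun z => z 0 j).
Proof.
rewrite (_ : (fun z => _) = fun z => 1 * monomial [ffun k => nat_of_bool (k == j)] z).
  by apply: polydeg_monomial => k; rewrite ffunE; case: (k == j).
apply/funext => z; rewrite mul1r /monomial (bigD1 j) //= ffunE eqxx expr1.
by rewrite big1 ?mulr1 // => k kj; rewrite ffunE (negbTE kj).
Qed.

Definition polyfun p : Prop := exists d, polydeg d p.

Lemma polyfun_cst (c : C) : polyfun (fun=> c).
Proof. by exists 1%N; exact: polydeg_cst. Qed.

Lemma polyfunD p q : polyfun p -> polyfun q -> polyfun (fun z => p z + q z).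
Proof.
move=> [d hp] [d' hq]; exists (maxn d d'); apply: polydegD.
  by apply: polydeg_leq hp; exact: leq_maxl.
by apply: polydeg_leq hq; exact: leq_maxr.
Qed.

Lemma polyfunM p q : polyfun p -> polyfun q -> polyfun (fun z => p z * q z).
Proof. by move=> [d hp] [d' hq]; exists (d + d')%N; exact: polydegM. Qed.

Lemma polyfunX p k : polyfun p -> polyfun (fun z => p z ^+ k).
Proof.
move=> hp; elim: k => [|k ih]; first exact: polyfun_cst.
by under eq_fun do rewrite exprS; exact: polyfunM.
Qed.

Lemma polyfun_sum (I : Type) (s : seq I) (P : pred I) (p : I -> 'rV[C]_n -> C) :
  (forall i, polyfun (p i)) -> polyfun (fun z => \sum_(i <- s | P i) p i z).
Proof.
move=> hp; elim: s => [|i s ih].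
  by under eq_fun do rewrite big_nil; exact: polyfun_cst.
under eq_fun do rewrite big_cons.
by case: (P i) => //; exact: polyfunD.
Qed.

Lemma polyfun_prod (I : Type) (s : seq I) (P : pred I) (p : I -> 'rV[C]_n -> C) :
  (forall i, polyfun (p i)) -> polyfun (fun z => \prod_(i <- s | P i) p i z).
Proof.
move=> hp; elim: s => [|i s ih].
  by under eq_fun do rewrite big_nil; exact: polyfun_cst.
under eq_fun do rewrite big_cons.
by case: (P i) => //; exact: polyfunM.
Qed.

(** The Szego kernel with its geometric series cut off: for the mean over the torus, the reproducing
    kernel of the polynomials of degree below [N] in each variable. *)
Definition szego N z w : C := \prod_(j < n) \sum_(k < N) (z 0 j * (w 0 j)^*) ^+ k.

Lemma polydeg_szego N w : polydeg N (szego N ^~ w).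
Proof.
rewrite (_ : (szego N ^~ w) = fun z => \sum_(f : {ffun 'I_n -> 'I_N})
  (\prod_(j < n) (w 0 j)^* ^+ f j) * monomial [ffun j => val (f j)] z).
  apply: polydeg_sum => f _; apply: polydeg_monomial => j.
  by rewrite ffunE ltn_ord.
apply/funext => z; rewrite /szego bigA_distr_bigA /=; apply: eq_bigr => f _.
rewrite /monomial -big_split; apply: eq_bigr => j _ /=.
by rewrite ffunE exprMn mulrC.
Qed.

Lemma conj_szego N z w : (szego N z w)^* = szego N w z.
Proof.
rewrite /szego rmorph_prod; apply: eq_bigr => j _; rewrite rmorph_sum.
by apply: eq_bigr => k _; rewrite rmorphXn rmorphM /= conjCK mulrC.
Qed.

End PolynomialFunctions.

Section Quadrature.
Variables (R : realType) (n N : nat) (om : R[i]).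
Hypothesis om_prim : N.-primitive_root om.
Local Notation C := R[i].
Implicit Types (z w : 'rV[C]_n) (u v : 'rV[C]_n -> C).

Let N0 : (0 < N)%N := prim_order_gt0 om_prim.

Lemma normc_prim_root : Normc.normc om = 1.
Proof.
have := prim_expr_order om_prim => /(congr1 (@Normc.normc R)).
rewrite normcX Normc.normc1 => /eqP; rewrite pexpr_eq1 ?normc_ge0 //.
by move/eqP.
Qed.

Let om0 : om != 0.
Proof.
apply/eqP => h; have := normc_prim_root; rewrite h Normc.normc0 => /eqP.
by rewrite eq_sym oner_eq0.
Qed.

Lemma conj_prim_root : om^* = om^-1.
Proof.
have h : om * om^* = 1 by rewrite mulcJ normc_prim_root expr1n.
by apply: (mulfI om0); rewrite h divff.
Qed.

(** Orthogonality of the characters of a cyclic group: the sum over [a] kills the terms with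
    [k != m], and [M <= N] excludes aliasing between exponents. *)
Lemma quadrature1 (w : C) m M : (m < M)%N -> (M <= N)%N ->
  \sum_(a < N) (om ^+ a) ^+ m * \sum_(k < M) ((om ^+ a)^* * w) ^+ k =
  N%:R * w ^+ m.
Proof.
move=> mM MN; pose rho k := om ^+ m / om ^+ k.
transitivity (\sum_(k < M) w ^+ k * \sum_(a < N) rho k ^+ a).
  under eq_bigr do rewrite mulr_sumr; rewrite exchange_big /=.
  apply: eq_bigr => k _; rewrite mulr_sumr; apply: eq_bigr => a _.
  rewrite exprMn mulrA mulrC rmorphXn /= conj_prim_root /rho; congr (_ * _).
  by rewrite exprMn !exprVn -!exprM mulnC [(a * k)%N]mulnC.
rewrite (bigD1 (Ordinal mM)) //= [X in _ + X]big1 ?addr0 => [|k km].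
  have -> : rho m = 1 by rewrite /rho divff ?expf_neq0.
  rewrite (eq_bigr (fun=> 1)) => [|a _].
    by rewrite sumr_const card_ord mulrC.
  exact: expr1n.
suff -> : \sum_(a < N) rho k ^+ a = 0 by rewrite mulr0.
have rho1 : rho k != 1.
  apply: contra km => /eqP h; rewrite -val_eqE /=.
  have {h} : om ^+ m = om ^+ k.
    by rewrite -[LHS](divfK (_ : om ^+ k != 0)) ?expf_neq0 // -/(rho k) h mul1r.
  move/eqP; rewrite (eq_prim_root_expr om_prim) eq_sym !modn_small //.
    exact: leq_trans mM MN.
  exact: leq_trans (ltn_ord k) MN.
have := subrX1 (rho k) N; rewrite {1}/rho exprMn exprVn -!exprM mulnC.
rewrite [(k * N)%N]mulnC !exprM (prim_expr_order om_prim) !expr1n divr1 subrr.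
by move/esym/eqP; rewrite mulf_eq0 subr_eq0 (negbTE rho1) => /eqP.
Qed.

Definition grid (f : {ffun 'I_n -> 'I_N}) : 'rV[C]_n := \row_j om ^+ f j.

Definition gridavg u : C := (N%:R ^+ n)^-1 * \sum_f u (grid f).

Lemma grid_closed f : closed_polydisc R n (grid f).
Proof.
move=> j; rewrite mxE -[X in X <= _]/(Normc.normc _)%:C%C normcX normc_prim_root.
by rewrite expr1n.
Qed.

Lemma gridavg_monomial (m : {ffun 'I_n -> nat}) M w :
  (forall j, (m j < M)%N) -> (M <= N)%N ->
  gridavg (fun z => monomial m z * (szego M z w)^*) = monomial m w.
Proof.
move=> mM MN; rewrite /gridavg.
have -> : \sum_f monomial m (grid f) * (szego M (grid f) w)^* =
    \prod_(j < n) \sum_(a < N) (om ^+ a) ^+ m j *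
       \sum_(k < M) ((om ^+ a)^* * w 0 j) ^+ k.
  rewrite bigA_distr_bigA /=; apply: eq_bigr => f _.
  rewrite conj_szego /monomial /szego -big_split; apply: eq_bigr => j _ /=.
  by rewrite mxE; congr (_ * _); apply: eq_bigr => k _; rewrite mulrC.
under eq_bigr do rewrite quadrature1 //.
rewrite big_split /= prodr_const card_ord mulKf // expf_neq0 // pnatr_eq0.
by rewrite -lt0n.
Qed.

Lemma gridavgD u v : gridavg (fun z => u z + v z) = gridavg u + gridavg v.
Proof. by rewrite /gridavg big_split mulrDr. Qed.

Lemma gridavgZ c u : gridavg (fun z => c * u z) = c * gridavg u.
Proof. by rewrite /gridavg -mulr_sumr mulrCA. Qed.

Lemma gridavg_sum (I : Type) (s : seq I) (u : I -> 'rV[C]_n -> C) :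
  gridavg (fun z => \sum_(i <- s) u i z) = \sum_(i <- s) gridavg (u i).
Proof. by rewrite /gridavg exchange_big mulr_sumr. Qed.

Lemma gridavg_szego u M w : polydeg M u -> (M <= N)%N ->
  gridavg (fun z => u z * (szego M z w)^*) = u w.
Proof.
move=> [s [sd su]] MN; rewrite su.
transitivity (gridavg (fun z =>
    \sum_(t <- s) t.1 * (monomial t.2 z * (szego M z w)^*))).
  congr gridavg; apply/funext => z; rewrite su mulr_suml.
  by apply: eq_bigr => t _; rewrite mulrA.
rewrite gridavg_sum big_seq [RHS]big_seq; apply: eq_bigr => t ts.
by rewrite gridavgZ gridavg_monomial //; exact: sd.
Qed.

Lemma gridavg_ge0 u : (forall z, closed_polydisc R n z -> 0 <= complex.Re (u z)) ->
  0 <= complex.Re (gridavg u).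
Proof.
move=> u0; rewrite /gridavg -natrX -(rmorph_nat (real_complex R)) -fmorphV.
rewrite Re_realM mulr_ge0 ?invr_ge0 // Re_sum sumr_ge0 // => f _.
exact/u0/grid_closed.
Qed.

End Quadrature.

(** * Multipliers of the weighted Bergman spaces *)

Section SzegoMultiplier.
Variables (R : realType) (n : nat).
Local Notation C := R[i].

(** Expand |a b - M^2 c|^2 >= 0 and replace |a b|^2 by its bound M^2 |b|^2. Being pointwise, this
    form of the Cauchy-Schwarz inequality survives averaging over a grid. *)
Lemma quadratic_form_ge0 (a b c : C) (M : R) : Normc.normc a <= M ->
  0 <= complex.Re ((M ^+ 2)%:C%C * (b * b^*) + (- (2 * M ^+ 2))%:C%C * (a * b * c^*)
                   + (M ^+ 4)%:C%C * (c * c^*)).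
Proof.
move=> aM; rewrite !ReD !Re_realM !mulcJ /=.
have h : Normc.normc (a * b) ^+ 2 <= M ^+ 2 * Normc.normc b ^+ 2.
  rewrite Normc.normcM exprMn ler_wpM2r ?sqr_ge0 //.
  by rewrite lerXn2r ?nnegrE ?normc_ge0 ?(le_trans _ aM) ?normc_ge0.
have := sqr_ge0 (Normc.normc (a * b - (M ^+ 2)%:C%C * c)).
rewrite !sqr_normc in h *; move: (a * b) h => e h.
have -> : complex.Re (e * c^*) =
    complex.Re e * complex.Re c + complex.Im e * complex.Im c.
  by case: (e) (c) => e1 e2 [c1 c2] /=; ring.
case: e c b h => e1 e2 [c1 c2] [b1 b2] /= h; rewrite !mul0r subr0 !addr0 => h'.
nra.
Qed.

(* On a fine enough grid of the torus, [g] is the adjoint of multiplication by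
   [p] applied to [h], up to truncation, and both [<g, g>] and [<p g, h>] are
   the left-hand side.  The inequality is the Cauchy-Schwarz inequality for
   the latter, where [|p| <= M] on the grid. *)
Lemma szego_multiplier (p : 'rV[C]_n -> C) d (M : R) N l : 0 < M ->
  polydeg d p -> (forall z, closed_polydisc R n z -> Normc.normc (p z) <= M) ->
  complex.Re (hform (fun x y => (p x)^* * p y * szego N y x) l) <=
  M ^+ 2 * complex.Re (hform (fun x y => szego (N + d.+1) y x) l).
Proof.
(* The product [p * g] has degree below [d + N] in each variable, so the kernel of order [N']
   reproduces it; the successor makes [N'] positive, as a primitive root of that order requires. *)
move=> M0 hp pM; set N' := (N + d.+1)%N.
have [om hom] := @primitive_root_exists R N' ltac:(by rewrite /N' addnS).
pose avg := @gridavg R n N' om.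
pose g z := \sum_(s <- l) (s.1 * (p s.2)^*) * szego N z s.2.
pose h z := \sum_(s <- l) s.1 * szego N' z s.2.
have hg : polydeg N g by apply: polydeg_sum => s _; exact/polydegZ/polydeg_szego.
have hh : polydeg N' h by apply: polydeg_sum => s _; exact/polydegZ/polydeg_szego.
have hpg : polydeg N' (fun z => p z * g z).
  by apply: polydeg_leq (polydegM hp hg); rewrite /N' addnC leq_add2l.
have avg_comb (u : 'rV[C]_n -> C) m (c : C * 'rV[C]_n -> C) : polydeg m u ->
    (m <= N')%N ->
    avg (fun z => u z * (\sum_(t <- l) c t * szego m z t.2)^*) =
    \sum_(t <- l) (c t)^* * u t.2.
  move=> hu mN; rewrite /avg; transitivity (gridavg N' om (fun z =>
      \sum_(t <- l) (c t)^* * (u z * (szego m z t.2)^*))).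
    congr gridavg; apply/funext => z; rewrite rmorph_sum mulr_sumr.
    by apply: eq_bigr => t _; rewrite rmorphM /= mulrCA.
  rewrite gridavg_sum; apply: eq_bigr => t _.
  by rewrite gridavgZ (gridavg_szego hom).
set G := hform _ l; set B := hform _ l.
have eG1 : avg (fun z => g z * (g z)^*) = G.
  rewrite avg_comb //; last exact: leq_addr.
  rewrite /G /hform exchange_big /=; apply: eq_bigr => t _.
  rewrite mulr_sumr; apply: eq_bigr => s _; rewrite rmorphM /= conjCK; ring.
have eG2 : avg (fun z => p z * g z * (h z)^*) = G.
  rewrite avg_comb //.
  rewrite /G /hform exchange_big /=; apply: eq_bigr => t _.
  rewrite mulrA mulr_sumr; apply: eq_bigr => s _; ring.
have eB : avg (fun z => h z * (h z)^*) = B.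
  rewrite avg_comb //.
  rewrite /B /hform exchange_big /=; apply: eq_bigr => t _.
  rewrite mulr_sumr; apply: eq_bigr => s _; ring.
have := @gridavg_ge0 R n N' om hom (fun z =>
  (M ^+ 2)%:C%C * (g z * (g z)^*) + (- (2 * M ^+ 2))%:C%C * (p z * g z * (h z)^*)
                   + (M ^+ 4)%:C%C * (h z * (h z)^*)).
move/(_ (fun z hz => quadratic_form_ge0 (g z) (h z) (pM z hz))).
rewrite !gridavgD !gridavgZ -!/(avg _) eG1 eG2 eB !ReD !Re_realM => hpos.
(* The average reads M^2 G - 2 M^2 G + M^4 B >= 0 in real parts; dividing by M^2 gives the claim. *)
have M2 : 0 < M ^+ 2 by rewrite exprn_gt0.
rewrite (exprD M 2 2) in hpos; rewrite -(ler_pM2l M2).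
by move: (M ^+ 2) (complex.Re G) (complex.Re B) hpos => m x y hpos; lra.
Qed.

End SzegoMultiplier.

(** * Positivity for the kernels of the polydisc *)

Section PolydiscKernel.
Variables (R : realType) (n : nat).
Local Notation C := R[i].
Local Notation point := {z : 'rV[C]_n | polydisc R n z}.
Implicit Types (z w : 'rV[C]_n) (x y : point).

Lemma normc_lt1 (z : C) : (`|z| < 1) = (Normc.normc z < 1).
Proof. by rewrite -ltcR. Qed.

Lemma normc_le1 (z : C) : (`|z| <= 1) = (Normc.normc z <= 1).
Proof. by rewrite -lecR. Qed.

Lemma polydisc_mulcJ z w j : polydisc R n z -> polydisc R n w ->
  Normc.normc (z 0 j * (w 0 j)^*) < 1.
Proof.
move=> /(_ j); rewrite normc_lt1 => hz /(_ j); rewrite normc_lt1 => hw.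
rewrite Normc.normcM normc_conj (le_lt_trans _ hw) // ler_piMl ?normc_ge0 //.
exact: ltW.
Qed.

Lemma subr1_neq0 (t : C) : Normc.normc t < 1 -> 1 - t != 0.
Proof.
by move=> t1; rewrite subr_eq0; apply: contraTneq t1 => <-; rewrite Normc.normc1 ltxx.
Qed.

Lemma cvg_szego z w : polydisc R n z -> polydisc R n w ->
  cvgC (fun N => szego N z w) (polydisc_kernel 1 z w).
Proof.
move=> hz hw; apply: cvgC_prod => j.
have := binomial_series (polydisc_mulcJ j hz hw) ler01.
congr cvgC; apply/funext => N; apply: eq_bigr => k _.
by rewrite bcoef1 mul1r.
Qed.

Lemma schur_polydisc_kernel (a : R) : 0 <= a ->
  schur (fun x y => polydisc_kernel a (sval y) (sval x)).
Proof.
move=> a0; apply: schur_prod => j.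
apply: (@schur_lim _ _ (fun N x y => \sum_(k < N) (bcoef a k)%:C%C *
    (((sval x 0 j)^* ^+ k) * ((sval y 0 j)^* ^+ k)^*))) => [N|[z hz] [w hw]] /=.
  by apply: schur_sum => k; apply: schur_rank_one; exact: bcoef_ge0.
have := binomial_series (polydisc_mulcJ j hw hz) a0.
congr cvgC; apply/funext => N; apply: eq_bigr => k _; congr (_ * _).
by rewrite rmorphXn /= conjCK exprMn mulrC.
Qed.

Lemma polydisc_kernelD (a b : R) z w : polydisc R n z -> polydisc R n w ->
  polydisc_kernel (a + b) z w = polydisc_kernel a z w * polydisc_kernel b z w.
Proof.
move=> hz hw; rewrite /polydisc_kernel -big_split; apply: eq_bigr => j _ /=.
by rewrite opprD cpowD // subr1_neq0 // polydisc_mulcJ.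
Qed.

(** The arguments are ordered as in the Gram matrix of the kernel sections. The form is M^2 |v|^2 -
    |T v|^2, where v is a combination of kernel sections and T multiplies the section at [x] by
    [(p (sval x))^*]. *)
Lemma psd_polydisc_kernel (p : 'rV[C]_n -> C) (M lam : R) :
  0 < M -> 1 <= lam -> polyfun p ->
  (forall z, closed_polydisc R n z -> Normc.normc (p z) <= M) ->
  psd (fun x y => ((M ^+ 2)%:C%C - (p (sval x))^* * p (sval y)) *
                  polydisc_kernel lam (sval y) (sval x)).
Proof.
move=> M0 lam1 [d hp] pM.
have psd1 : psd (fun x y => polydisc_kernel 1 (sval y) (sval x) *
    ((M ^+ 2)%:C%C - (p (sval x))^* * p (sval y))).
  (* The truncations of the two terms differ in length but have the same limit. *)
  apply: (@psd_lim _ _ (fun N x y =>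
     (M ^+ 2)%:C%C * szego (N + d.+1) (sval y) (sval x) -
     (p (sval x))^* * p (sval y) * szego N (sval y) (sval x))) => [N l|x y].
    have := @szego_multiplier R n p d M N [seq (s.1, sval s.2) | s <- l] M0 hp pM.
    rewrite -subr_ge0 -Re_realM -ReB /hform !big_map mulr_sumr -sumrB.
    congr (_ <= complex.Re _); apply: eq_bigr => s _.
    rewrite !big_map mulr_sumr -sumrB; apply: eq_bigr => t _ /=; ring.
  rewrite [polydisc_kernel 1 _ _ * _]mulrC mulrBl.
  rewrite -[- (_ * polydisc_kernel _ _ _)]mulN1r.
  apply: cvgCD.
    apply: cvgCM; first exact: cvgC_cst.
    exact: (cvgC_shift d.+1 (cvg_szego (svalP y) (svalP x))).
  rewrite (_ : (fun N => _) = (fun N => -1 * ((p (sval x))^* * p (sval y) *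
    szego N (sval y) (sval x)))); last by apply/funext => N; rewrite mulN1r.
  apply: cvgCM; first exact: cvgC_cst.
  apply: cvgCM; first exact: cvgC_cst.
  exact: (cvg_szego (svalP y) (svalP x)).
have := schur_polydisc_kernel (_ : 0 <= lam - 1) psd1.
rewrite subr_ge0 => /(_ lam1); congr psd.
apply/funext => x; apply/funext => y; rewrite mulrA -polydisc_kernelD; last 2 first.
- exact: svalP.
- exact: svalP.
by rewrite subrK mulrC.
Qed.

End PolydiscKernel.

(** * Multiplication and permutation of variables on the weighted Bergman space *)

Section BergmanSpace.
Variables (R : realType) (n : nat) (lam : R).
Local Notation C := R[i].
Local Notation point := {z : 'rV[C]_n | polydisc R n z}.
Variables (H : set ('rV[C]_n -> C)) (ip : ('rV[C]_n -> C) -> ('rV[C]_n -> C) -> C).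
Hypothesis hH : is_bergman_space lam H ip.
Implicit Types (f : 'rV[C]_n -> C) (x y : point) (l : seq (C * point)).

Local Notation hn := (hnorm ip).
Local Notation hilb := (berg_hilbert hH).

Let ker x := kernel_section lam (sval x).

Let Hker x : H (ker x).
Proof. exact: (berg_kernel hH (svalP x)). Qed.

Let ip_ker x y : ip (ker x) (ker y) = polydisc_kernel lam (sval y) (sval x).
Proof.
rewrite (berg_reproducing hH (Hker x) (svalP y)) /ker /kernel_section.
by rewrite mem_set //; exact: svalP.
Qed.

Let ip_lincomb l f : H f ->
  ip (lincomb ker l) f = \sum_(t <- l) t.1 * (f (sval t.2))^*.
Proof.
move=> Hf; rewrite /lincomb (ip_suml hilb) // => [|t]; last exact: (hilb_scale hilb).
apply: eq_bigr => t _; rewrite (ipZl hilb) // (hilb_ip_sym hilb) //.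
by rewrite (berg_reproducing hH Hf (svalP t.2)).
Qed.

Let sqr_hnorm_comb l : hn (lincomb ker l) ^+ 2 =
  complex.Re (hform (fun x y => polydisc_kernel lam (sval y) (sval x)) l).
Proof.
rewrite (sqr_hnorm_lincomb hilb) //; congr complex.Re; apply: eq_bigr => s _.
by apply: eq_bigr => t _; rewrite ip_ker.
Qed.

(** Elements of [H] vanish off the polydisc and take their values on it through the kernel sections,
    so that the interpolating vector is [phi] itself. *)
Lemma bergman_interpolation (phi : 'rV[C]_n -> C) (c : R) : 0 <= c ->
  (forall z, ~ polydisc R n z -> phi z = 0) ->
  (forall l, Normc.normc (\sum_(t <- l) t.1 * (phi (sval t.2))^*) ^+ 2 <=
    c ^+ 2 * complex.Re
      (hform (fun x y => polydisc_kernel lam (sval y) (sval x)) l)) ->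
  H phi /\ hn phi <= c.
Proof.
move=> c0 phi0 hphi.
have [|h [Hh hk hc]] := @interpolation _ _ _ _ hilb _ _ Hker (phi \o sval) c c0.
  move=> l; rewrite -(@ler_sqr _ _ _) ?nnegrE ?normc_ge0 ?mulr_ge0 ?hnorm_ge0 //.
  by rewrite exprMn sqr_hnorm_comb; exact: hphi.
suff -> : phi = h by [].
apply/funext => z; have [hz|hz] := pselect (polydisc R n z).
  by have := hk (exist _ z hz); rewrite (berg_reproducing hH Hh hz).
by rewrite phi0 // (berg_support hH Hh).
Qed.

Let sqr_cauchy_schwarz f g : H f -> H g ->
  Normc.normc (ip f g) ^+ 2 <= hn f ^+ 2 * hn g ^+ 2.
Proof.
move=> Hf Hg; rewrite -exprMn lerXn2r ?nnegrE ?normc_ge0 ?mulr_ge0 ?hnorm_ge0 //.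
exact: (cauchy_schwarz hilb).
Qed.

Lemma polyfun_multiplier (p : 'rV[C]_n -> C) (M : R) f : 1 <= lam -> 0 < M ->
  polyfun p -> (forall z, closed_polydisc R n z -> Normc.normc (p z) <= M) ->
  H f -> H (fun z => p z * f z) /\ hn (fun z => p z * f z) <= M * hn f.
Proof.
move=> lam1 M0 hp pM Hf; apply: bergman_interpolation.
- by rewrite mulr_ge0 ?hnorm_ge0 // ltW.
- by move=> z hz; rewrite (berg_support hH Hf hz) mulr0.
(* [lincomb ker l'] is what the adjoint of multiplication by [p] makes of [lincomb ker l]. *)
move=> l; pose l' := [seq (t.1 * (p (sval t.2))^*, t.2) | t <- l].
have -> : \sum_(t <- l) t.1 * (p (sval t.2) * f (sval t.2))^* =
    ip (lincomb ker l') f.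
  rewrite ip_lincomb // big_map; apply: eq_bigr => t _.
  by rewrite rmorphM /= mulrA.
have Hl := lincomb_in hilb Hker l'.
apply: le_trans (sqr_cauchy_schwarz Hl Hf) _; rewrite exprMn [leRHS]mulrAC.
rewrite ler_wpM2r ?sqr_ge0 // sqr_hnorm_comb.
have := psd_polydisc_kernel M0 lam1 hp pM l.
rewrite -Re_realM -[_ <= complex.Re (_ * _)]subr_ge0 -ReB.
congr (_ <= complex.Re _); rewrite /hform mulr_sumr big_map -sumrB.
apply: eq_bigr => s _; rewrite mulr_sumr big_map -sumrB; apply: eq_bigr => t _ /=.
by rewrite [(t.1 * _)^*]rmorphM /= conjCK; ring.
Qed.

Lemma polydisc_permute (s : 'S_n) (z : 'rV[C]_n) :
  polydisc R n z -> polydisc R n (permute s z).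
Proof. by move=> hz j; rewrite mxE. Qed.

Lemma permuteK (s : 'S_n) (z : 'rV[C]_n) : permute s (permute s^-1 z) = z.
Proof. by apply/rowP => j; rewrite !mxE invgK permKV. Qed.

Lemma polydisc_kernel_permute (s : 'S_n) (z w : 'rV[C]_n) :
  polydisc_kernel lam (permute s z) (permute s w) = polydisc_kernel lam z w.
Proof.
rewrite /polydisc_kernel [RHS](reindex_inj (@perm_inj _ s^-1)%g) /=.
by apply: eq_bigr => j _; rewrite !mxE.
Qed.

(** As the kernel is invariant under a simultaneous permutation of its arguments, moving the points
    of a combination of kernel sections by [s] preserves its norm. *)
Lemma permute_contraction (s : 'S_n) f : H f ->
  H (fun z => f (permute s z)) /\ hn (fun z => f (permute s z)) <= hn f.
Proof.
move=> Hf; apply: bergman_interpolation; first exact: hnorm_ge0.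
  move=> z hz; apply: (berg_support hH Hf) => hz'; apply: hz.
  by rewrite -(permuteK s^-1 z) invgK; exact: polydisc_permute.
move=> l; pose sp (x : point) : point := exist _ _ (polydisc_permute s (svalP x)).
have -> : \sum_(t <- l) t.1 * (f (permute s (sval t.2)))^* =
    ip (lincomb ker [seq (t.1, sp t.2) | t <- l]) f.
  by rewrite ip_lincomb // big_map.
set l' := [seq _ | t <- l]; have Hl := lincomb_in hilb Hker l'.
apply: le_trans (sqr_cauchy_schwarz Hl Hf) _.
rewrite mulrC ler_wpM2l ?sqr_ge0 // sqr_hnorm_comb.
rewrite /hform big_map le_eqVlt; apply/orP; left; apply/eqP; congr complex.Re.
apply: eq_bigr => u _; rewrite big_map; apply: eq_bigr => t _ /=.
by rewrite polydisc_kernel_permute.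
Qed.

End BergmanSpace.

(** * The isotypic projection *)

Section IsotypicProjection.
Variables (R : realType) (n d : nat).
Local Notation C := R[i].
Local Notation Sn := [set: 'S_n]%G.
Variables (rG : mx_representation C Sn d) (i : 'I_d).
Hypothesis irrG : mx_irreducible rG.

Local Notation P := (isotypic_proj rG i).

Lemma permuteM (s t : 'S_n) (z : 'rV[C]_n) :
  permute s (permute t z) = permute (t * s)%g z.
Proof. by apply/rowP => j; rewrite !mxE invMg permM. Qed.

(* The sum of [rG s^-1 E rG s], with [E] the matrix unit at [(i, i)], is a scalar
   matrix by Schur's lemma; its trace gives the scalar. *)
Lemma schur_orthogonality (u : 'S_n) :
  d%:R * \sum_(s : 'S_n) rG s^-1%g i i * rG (s * u)%g i i = n`!%:R * rG u i i.
Proof.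
pose A := \sum_(s : 'S_n) rG s^-1%g *m delta_mx i i *m rG s.
have centA : centgmx rG A.
  apply/centgmxP => t _; rewrite /A mulmx_suml mulmx_sumr.
  rewrite [RHS](reindex_inj (mulIg t)) /=; apply: eq_bigr => s _.
  rewrite invMg !repr_mxM ?inE // !mulmxA -(repr_mxM rG (x := t)) ?inE //.
  by rewrite mulgV repr_mx1 mul1mx.
have /is_scalar_mxP[a eA] :=
  mx_abs_irr_cent_scalar (@group_closure_closed_field C _ _ _ rG irrG) centA.
have ha : d%:R * a = n`!%:R.
  transitivity (\tr A); first by rewrite eA mxtrace_scalar mulr_natl.
  rewrite /A raddf_sum (eq_bigr (fun=> 1)) => [|s _] /=.
    by rewrite sumr_const card_Sn.
  rewrite mxtrace_mulC mulmxA -repr_mxM ?inE // mulgV repr_mx1 mul1mx.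
  rewrite /mxtrace (bigD1 i) //= mxE !eqxx big1 ?addr0 // => j ji.
  by rewrite mxE (negbTE ji).
rewrite -ha -mulrA; congr (_ * _).
transitivity ((A *m rG u) i i); last by rewrite eA mul_scalar_mx mxE.
rewrite /A mulmx_suml summxE; apply: eq_bigr => s _.
rewrite -mulmxA -repr_mxM ?inE // -mulmxA mxE (bigD1 i) //= big1 ?addr0.
  rewrite mxE (bigD1 i) //= big1 ?addr0 => [|j ji]; last first.
    by rewrite mxE (negbTE ji) andbF mul0r.
  by rewrite mxE !eqxx mul1r.
move=> j ji; rewrite mxE big1 ?mulr0 // => k _.
by rewrite mxE (negbTE ji) mul0r.
Qed.

Lemma isotypic_proj_linear (a : C) (f g : 'rV[C]_n -> C) :
  P (a *: f + g) = a *: P f + P g.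
Proof.
apply/funext => z; rewrite /isotypic_proj !fctE.
rewrite /GRing.scale /= [a * (_ * _)]mulrCA -mulrDr; congr (_ * _).
rewrite mulr_sumr -big_split.
by apply: eq_bigr => s _ /=; ring.
Qed.

Lemma isotypic_proj_id (f : 'rV[C]_n -> C) : P (P f) = P f.
Proof.
have d0 : d%:R != 0 :> C by rewrite pnatr_eq0 -lt0n (leq_ltn_trans _ (ltn_ord i)).
have n0 : n`!%:R != 0 :> C by rewrite pnatr_eq0 -lt0n fact_gt0.
apply/funext => z; rewrite {1 3}/isotypic_proj; congr (_ * _).
(* With [u] for the composite of the two permutations, the sum over [s] is the convolution that
   [schur_orthogonality] evaluates at [u^-1]. *)
transitivity (\sum_(s : 'S_n) \sum_(u : 'S_n) d%:R / n`!%:R *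
    (rG s^-1%g i i * rG (s * u^-1)%g i i) * f (permute u^-1%g z)).
  apply: eq_bigr => s _; rewrite /isotypic_proj.
  rewrite (reindex_inj (mulIg s^-1%g)) mulrCA !mulr_sumr; apply: eq_bigr => u _ /=.
  by rewrite permuteM invMg invgK mulKg; ring.
rewrite exchange_big; apply: eq_bigr => u _ /=.
rewrite -mulr_suml -mulr_sumr [d%:R / _ * _]mulrAC schur_orthogonality.
by rewrite [n`!%:R * _ / _]mulrAC divff // mul1r.
Qed.

Lemma isotypic_proj_mul (p f : 'rV[C]_n -> C) :
  (forall s z, p (permute s z) = p z) ->
  P (fun z => p z * f z) = fun z => p z * P f z.
Proof.
move=> hp; apply/funext => z; rewrite /isotypic_proj mulrCA; congr (_ * _).
by rewrite mulr_sumr; apply: eq_bigr => s _; rewrite hp mulrCA.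
Qed.

End IsotypicProjection.

(** * Elementary symmetric polynomials and polynomials in them *)

Section ElementarySymmetric.
Variables (R : realType) (n : nat).
Local Notation C := R[i].

(* Unqualified, [esym] is the symmetry of equality. *)
Lemma esymE k (z : 'rV[C]_n) :
  Defs.esym k z = \sum_(h : {set 'I_n} | #|h| == k) \prod_(j in h) z 0 j.
Proof.
rewrite /Defs.esym /mpoly.mesym rmorph_sum; apply: eq_bigr => h _.
by rewrite rmorph_prod; apply: eq_bigr => j _; rewrite /= mpoly.mevalXU.
Qed.

Lemma esym_permute k (s : 'S_n) (z : 'rV[C]_n) :
  Defs.esym k (permute s z) = Defs.esym k z.
Proof.
rewrite !esymE (reindex_inj (imset_inj (@perm_inj _ s))) /=.
apply: eq_big => [h|h _]; first by rewrite card_imset //; exact: perm_inj.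
rewrite big_imset /=; last by move=> ? ? _ _; exact: perm_inj.
by apply: eq_bigr => j _; rewrite mxE permK.
Qed.

Lemma polyfun_esym k : polyfun (@Defs.esym R n k).
Proof.
rewrite (funext (esymE k)); apply: polyfun_sum => h.
by apply: polyfun_prod => j; exists 2%N; exact: polydeg_coord.
Qed.

(** A crude count of monomials, each of modulus at most 1; it serves to make the multiplications
    bounded operators, for which any constant will do. *)
Lemma normc_esym_le k (z : 'rV[C]_n) : closed_polydisc R n z ->
  Normc.normc (Defs.esym k z) <= #|{set 'I_n}|%:R.
Proof.
move=> hz; rewrite esymE (le_trans (ler_normc_sum _ _ _)) //.
rewrite -sum1_card natr_sum [leRHS](bigID (fun h : {set 'I_n} => #|h| == k)) /=.
rewrite ler_wpDr ?sumr_ge0 // ler_sum // => h _.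
rewrite normc_prod prodr_ile1 // => j _.
by rewrite normc_ge0 -normc_le1; exact: hz.
Qed.

Lemma op_polyE (q : mpoly.mpoly n C) (f : 'rV[C]_n -> C) :
  op_poly mul_esym q f =
  fun z => mpoly.meval (fun k : 'I_n => Defs.esym k.+1 z) q * f z.
Proof.
apply/funext => z; rewrite mpoly.mevalE mulr_suml /op_poly fct_sumE.
apply: eq_bigr => m _; rewrite -mulrA; congr (_ * _).
rewrite /op_monomial -big_enum /=.
elim: (enum 'I_n) => [|k s ih] /=; first by rewrite big_nil mul1r.
rewrite big_cons -mulrA -ih; elim: (mpoly.fun_of_multinom m k) => [|j ihj] /=.
  by rewrite expr0 mul1r.
by rewrite /mul_esym exprS -mulrA -ihj.
Qed.

End ElementarySymmetric.

(** * Symmetric multipliers on the range of the projection *)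

Section IsotypicComponent.
Variables (R : realType) (n d : nat).
Local Notation C := R[i].
Local Notation Sn := [set: 'S_n]%G.
Variables (rG : mx_representation C Sn d) (i : 'I_d) (lam : R).
Hypotheses (irrG : mx_irreducible rG) (lam1 : 1 <= lam).
Variables (H : set ('rV[C]_n -> C)) (ip : ('rV[C]_n -> C) -> ('rV[C]_n -> C) -> C).
Hypothesis hH : is_bergman_space lam H ip.
Implicit Types (f g : 'rV[C]_n -> C).

Local Notation P := (isotypic_proj rG i).
Local Notation hn := (hnorm ip).
Local Notation hilb := (berg_hilbert hH).

Let coef (s : 'S_n) : C := d%:R / n`!%:R * rG s^-1%g i i.

Let isotypic_projE f :
  P f = \sum_(s : 'S_n) coef s *: (fun z => f (permute s^-1%g z)).
Proof.
apply/funext => z; rewrite /isotypic_proj fct_sumE mulr_sumr.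
by apply: eq_bigr => s _; rewrite mulrA.
Qed.

Lemma isotypic_proj_stable f : H f -> H (P f).
Proof.
move=> Hf; rewrite isotypic_projE; apply: (hilb_sum hilb) => s.
exact/(hilb_scale hilb)/(permute_contraction hH _ Hf).1.
Qed.

Lemma isotypic_proj_bounded f : H f ->
  hn (P f) <= (\sum_(s : 'S_n) Normc.normc (coef s)) * hn f.
Proof.
move=> Hf; have Hs (s : 'S_n) := permute_contraction hH s^-1%g Hf.
rewrite isotypic_projE; apply: le_trans (hnorm_sum hilb _ _) _ => [s|].
  exact/(hilb_scale hilb)/(Hs s).1.
rewrite mulr_suml ler_sum // => s _; have [Hfs fs_le] := Hs s.
by rewrite (hnormZ hilb) // ler_wpM2l ?normc_ge0.
Qed.

(** Idempotence makes the range a fixed space, a description that passes to limits and to products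
    with symmetric functions. *)
Lemma isotypic_imageE f : (P @` H) f <-> H f /\ P f = f.
Proof.
split=> [[g Hg <-]|[Hf <-]]; last by exists f.
by split; [exact: isotypic_proj_stable|exact: isotypic_proj_id].
Qed.

Lemma isotypic_image_hilbert : is_hilbert (P @` H) ip.
Proof.
have sub f : (P @` H) f -> H f by move=> /isotypic_imageE[].
split.
- exists 0; first exact: hilb_zero hilb.
  have := isotypic_proj_linear rG i (- 1) 0 0.
  by rewrite scaler0 addr0 scaleN1r addNr.
- move=> a f g /isotypic_imageE[Hf Pf] /isotypic_imageE[Hg Pg].
  apply/isotypic_imageE; split; first exact: (hilb_lin hilb).
  by rewrite isotypic_proj_linear Pf Pg.
- by move=> a f g h /sub Hf /sub Hg /sub Hh; exact: (hilb_ip_lin hilb).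
- by move=> f g /sub Hf /sub Hg; exact: (hilb_ip_sym hilb).
- by move=> f /sub Hf; exact: (hilb_ip_pos hilb).
move=> u Pu cauchy; have Hu m : H (u m) by exact: sub.
have [f Hf cvf] := hilb_complete hilb Hu cauchy.
exists f => //; apply/isotypic_imageE; split=> //.
have HPf := isotypic_proj_stable Hf.
apply/eqP; rewrite -subr_eq0; apply/eqP/(hnorm_eq0 hilb).
  exact: (hilb_sub hilb).
apply/eqP; rewrite eq_le hnorm_ge0 andbT; apply/ler_addgt0Pr => e e0; rewrite add0r.
pose K := \sum_(s : 'S_n) Normc.normc (coef s).
have K0 : 0 <= K by apply: sumr_ge0 => s _; exact: normc_ge0.
have [|N hN] := cvf (e / (K + 1)); first by rewrite divr_gt0 // ltr_wpDl.
have := hN N (leqnn N); rewrite ltr_pdivlMr ?ltr_wpDl // => hlt.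
have PuN : P (u N) = u N by have /isotypic_imageE[] := Pu N.
(* Since [P] fixes [u N], the defect is controlled by [u N - f] alone, with factor [K + 1]; hence
   the choice of the tolerance. *)
have -> : P f - f = - P (u N - f) + (u N - f).
  have -> : P (u N - f) = u N - P f.
    by rewrite addrC -scaleN1r isotypic_proj_linear PuN scaleN1r addrC.
  by rewrite opprB addrA subrK.
have HuN := hilb_sub hilb (Hu N) Hf; have HPuN := isotypic_proj_stable HuN.
rewrite (le_trans (hnormD hilb (hilb_opp hilb HPuN) HuN)) // (hnormN hilb) //.
have := isotypic_proj_bounded HuN; rewrite -/K.
by move: (hn _) (hn _) hlt => a b hlt hb; lra.
Qed.

Lemma isotypic_multiplier (p : 'rV[C]_n -> C) (M : R) f : 0 < M -> polyfun p ->
  (forall z, closed_polydisc R n z -> Normc.normc (p z) <= M) ->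
  (forall s z, p (permute s z) = p z) -> (P @` H) f ->
  (P @` H) (fun z => p z * f z) /\ hn (fun z => p z * f z) <= M * hn f.
Proof.
move=> M0 hp pM psym /isotypic_imageE[Hf Pf].
have [Hpf pf_le] := polyfun_multiplier hH lam1 M0 hp pM Hf.
by split=> //; apply/isotypic_imageE; rewrite isotypic_proj_mul // Pf.
Qed.

Lemma mul_esym_bounded (k : 'I_n) : bounded_operator (P @` H) ip (mul_esym k).
Proof.
pose M : R := #|{set 'I_n}|%:R + 1.
have M0 : 0 < M by rewrite ltr_wpDl.
have hM f := @isotypic_multiplier (Defs.esym k.+1) M f M0 (polyfun_esym _ _ _).
have {}hM f : (P @` H) f -> (P @` H) (mul_esym k f) /\ hn (mul_esym k f) <= M * hn f.
  move=> Pf; apply: hM => // [z hz|s z]; last exact: esym_permute.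
  by rewrite (le_trans (normc_esym_le _ hz)) // lerDl.
split=> [f /hM[]//|a f g _ _|]; last by exists M => f /hM[].
by apply/funext => z; rewrite /mul_esym !fctE /GRing.scale /=; ring.
Qed.

Lemma op_poly_esym_bound (q : mpoly.mpoly n C) :
  (opnorm (P @` H) ip (op_poly mul_esym q) <=
   ereal_sup [set (Normc.normc (mpoly.meval (fun k => u 0%R k) q))%:E
             | u in Gamma R n])%E.
Proof.
set S := ereal_sup _.
have pS z : closed_polydisc R n z ->
    ((Normc.normc (mpoly.meval (fun k : 'I_n => Defs.esym k.+1 z) q))%:E <= S)%E.
  move=> hz; apply: ereal_sup_ubound; exists (symmap z); first by exists z.
  by congr (Normc.normc (mpoly.meval _ q))%:E; apply/funext => k; rewrite mxE.
(* The value at the origin keeps the supremum from being -oo. *)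
have S0 : (0%:E <= S)%E.
  apply: (le_trans _ (pS 0 _)); first by rewrite lee_fin normc_ge0.
  by move=> j; rewrite mxE normr0 ler01.
apply: ge_ereal_sup => _ [f [Pf f1] <-].
case: S pS S0 => [r| |] pS S0; rewrite ?leey //.
rewrite lee_fin in S0; rewrite lee_fin; apply/ler_addgt0Pr => e e0.
(* [isotypic_multiplier] asks for a positive bound, whereas [r] is 0 when [q] vanishes on
   [Gamma]. *)
have re0 : 0 < r + e by rewrite ltr_wpDl.
rewrite op_polyE.
pose p (z : 'rV[C]_n) := mpoly.meval (fun k : 'I_n => Defs.esym k.+1 z) q.
have hp : polyfun p.
  rewrite /p; under eq_fun do rewrite mpoly.mevalE.
  apply: polyfun_sum => m; apply: polyfunM; first exact: polyfun_cst.
  by apply: polyfun_prod => k; exact/polyfunX/polyfun_esym.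
have [||_ h] := @isotypic_multiplier p _ f re0 hp _ _ Pf.
- by move=> z /pS; rewrite lee_fin => h; rewrite (le_trans h) // lerDl ltW.
- move=> s z; rewrite /p; congr (mpoly.meval _ q); apply/funext => k.
  exact: esym_permute.
by rewrite (le_trans h) // ler_piMr // ltW.
Qed.

End IsotypicComponent.

Theorem theorem3p11 (R : realType) (n : nat) (hn : (0 < n)%N)
    (p : seq nat) (hp : is_partition n p)
    (d : nat) (rG : mx_representation R[i] [set: 'S_n]%G d)
    (hrG : unitary_irrep_of p rG) (i : 'I_d)
    (lam : R) (hlam : 1 <= lam)
    (H : set ('rV[R[i]]_n -> R[i]))
    (ip : ('rV[R[i]]_n -> R[i]) -> ('rV[R[i]]_n -> R[i]) -> R[i])
    (hH : is_bergman_space lam H ip) :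
  Gamma_contraction (isotypic_proj rG i @` H) ip mul_esym.
Proof.
have [irrG _ _] := hrG; split.
- exact: isotypic_image_hilbert hH.
- exact: mul_esym_bounded hH.
- by move=> k l f _; apply/funext => z; rewrite /mul_esym mulrCA.
- exact: op_poly_esym_bound hH.
Qed.
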